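(* Let $\delta<1$ be a constant, let $\epsilon=(1-\delta)/4$, let $m=n^{\epsilon}$, and let $k\le \delta\log_2 n$. Then there exists a masking function $\phi$ (mapping $k$ strings $y_1,\dots,y_k\in\{0,1\}^n$ to an $m$-element subset of $[1,n]$) such that $R_{k+1}(\mathrm{Lift}(\mathrm{OR},\phi))\ge n^{\Omega(1)}$.
   Context: For $x\in\{0,1\}^n$ and $S\subseteq[1,n]$, $x|S$ denotes the substring of $x$ indexed by the elements of $S$ (in increasing order). Functions take values in $\{-1,1\}$, with $-1$ meaning true. $\mathrm{OR}:\{0,1\}^m\to\{-1,1\}$ equals $-1$ iff some input bit is $1$. Given $\phi:(\{0,1\}^n)^k\to\{S\subseteq[1,n]:|S|=m\}$, define $\mathrm{Lift}(\mathrm{OR},\phi):(\{0,1\}^n)^{k+1}\to\{-1,1\}$ by $\mathrm{Lift}(\mathrm{OR},\phi)(x,y_1,\dots,y_k)=\mathrm{OR}(x|\phi(y_1,\dots,y_k))$. This is computed in the number-on-forehead model by $k+1$ players: player $0$ has $x$ on its forehead and player $i$ ($1\le i\le k$) has $y_i$; each player sees all inputs except its own, and they communicate by writing bits on a shared blackboard. $R_{k+1}(F)$ is the minimum cost (maximum number of bits written) of a public-coin randomized protocol (a probability distribution over deterministic protocols) that computes $F$ with error probability at most $1/3$ on every input. The bound $n^{\Omega(1)}$ is asymptotic in $n$, with the implied constant depending only on $\delta$. *)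

(* Defs.v *)
From HB Require Import structures.
From mathcomp Require Import all_boot all_order all_algebra.
From mathcomp Require Import all_classical all_reals all_analysis.

Set Implicit Arguments.
Unset Strict Implicit.
Unset Printing Implicit Defensive.

Import Order.TTheory GRing.Theory Num.Theory.

Local Open Scope classical_set_scope.
Local Open Scope ring_scope.

Definition log2 (K : realType) (x : K) : K := ln x / ln 2.

(* Truth values in {-1, 1}, with -1 meaning true. *)
Definition pm1 (b : bool) : int := if b then -1 else 1.

Definition OR (m : nat) (w : m.-tuple bool) : int := pm1 (has id w).

Definition bits (n : nat) := n.-tuple bool.

Definition strings (n k : nat) := {ffun 'I_k -> bits n}.

Definition msubset (n m : nat) := {S : {set 'I_n} | #|S| == m}.

Lemma size_substr (n m : nat) (x : bits n) (S : msubset n m) :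
  size [seq tnth x i | i <- enum (val S)] == m.
Proof. by rewrite size_map -cardE (valP S). Qed.

(* x|S: [enum] lists the elements of S in increasing order. *)
Definition substr (n m : nat) (x : bits n) (S : msubset n m) : m.-tuple bool :=
  Tuple (size_substr x S).

Definition masking (n m k : nat) := strings n k -> msubset n m.

(* In [z : strings n k.+1], [z i] is the string on the forehead of player i.
   As j ranges over 'I_k, [lift i j] ranges in order over the players other
   than i; so [seen i z] is everything that player i sees, and when
   z = (x, y_1, .., y_k), [seen ord0 z] is (y_1, .., y_k). *)
Definition seen (n k : nat) (i : 'I_k.+1) (z : strings n k.+1) : strings n k :=
  [ffun j => z (lift i j)].

Definition Lift (n m k : nat) (f : m.-tuple bool -> int) (phi : masking n m k)
    (z : strings n k.+1) : int :=
  f (substr (z ord0) (phi (seen ord0 z))).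

(* Deterministic number-on-forehead protocols for k+1 players. A node is a
   state of the blackboard: either the outcome is known, or player i writes
   the bit [msg (seen i z)] and the protocol goes on with p1 if the bit is 1
   and with p0 if it is 0. *)
Inductive protocol (n k : nat) : Type :=
| Output of bool
| Speak (i : 'I_k.+1) (msg : strings n k -> bool) (p0 p1 : protocol n k).

Arguments Output {n k} _.
Arguments Speak {n k} _ _ _ _.

Fixpoint run (n k : nat) (p : protocol n k) (z : strings n k.+1) : int :=
  match p with
  | Output b => pm1 b
  | Speak i msg p0 p1 => if msg (seen i z) then run p1 z else run p0 z
  end.

Fixpoint written (n k : nat) (p : protocol n k) (z : strings n k.+1) : nat :=
  match p with
  | Output _ => 0%N
  | Speak i msg p0 p1 =>
      (if msg (seen i z) then written p1 z else written p0 z).+1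
  end.

Definition cost (n k : nat) (p : protocol n k) : nat :=
  (\max_(z : strings n k.+1) written p z)%N.

(* There are only countably many deterministic protocols for given n and k,
   so they carry the discrete sigma-algebra. *)
HB.instance Definition _ (n k : nat) := gen_eqMixin (protocol n k).
HB.instance Definition _ (n k : nat) := gen_choiceMixin (protocol n k).
HB.instance Definition _ (n k : nat) :=
  isPointed.Build (protocol n k) (Output false).
HB.instance Definition _ (n k : nat) := @isMeasurable.Build
  default_measure_display (protocol n k) discrete_measurable
  discrete_measurable0 discrete_measurableC discrete_measurableU.

(* A public-coin randomized protocol is a probability distribution over
   deterministic protocols. *)
Definition rand_protocol (K : realType) (n k : nat) :=
  probability (protocol n k) K.

Definition rand_computes (K : realType) (n k : nat) (mu : rand_protocol K n k)
    (F : strings n k.+1 -> int) : Prop :=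
  forall z, (mu [set p | run p z <> F z] <= (1 / 3)%:E)%E.

Definition rand_cost_le (K : realType) (n k : nat) (mu : rand_protocol K n k)
    (c : nat) : Prop :=
  mu [set p | (c < cost p)%N] = 0%E.

(* R_{k+1}(F). The infimum is over natural numbers, hence a minimum, except
   that it is +oo when no protocol of bounded cost computes F. *)
Definition rand_cc (K : realType) (n k : nat) (F : strings n k.+1 -> int) :
    \bar K :=
  ereal_inf [set (c%:R)%:E | c in [set c : nat |
    exists mu : rand_protocol K n k, rand_computes mu F /\ rand_cost_le mu c]].

(* Main.v *)
(** The hard distribution comes from a dual polynomial for OR: a signed weight
    [w] on Hamming weights, orthogonal to all polynomials of degree at most
    [h ~ sqrt m] and carrying almost half of its mass on the all-zero string.
    For a random mask [phi] the function
    [G(x, y) = 2^m w(|x restricted to phi(y)|)] correlates with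
    [Lift(OR, phi)].  A protocol of cost [c] is a signed sum of [2^c] cylinder
    intersections, and by iterated Cauchy-Schwarz the [2^k]-th power of the
    correlation of [G] with a cylinder intersection is at most the average,
    over cubes [(y_i^0, y_i^1)], of [|E_x prod_u psi_(S_u)(x)|], where the
    [2^k] sets [S_u] are the values of [phi] on the vertices of the cube.
    Orthogonality makes this expectation vanish unless every [S_u] meets the
    others in more than [h] points; it never exceeds [2^q], where [q] is the
    total overlap.  Since [m^2 2^k << n], random [m]-subsets of [1, n] have
    such a large overlap with probability small enough to give a bound of
    [(2 / 2^h)^(2^k)] on average, hence for some [phi]; so [c >= h - O(1)]. *)
Require Import Defs.
From mathcomp Require Import all_boot all_order all_algebra.
From mathcomp Require Import all_classical all_reals all_analysis.
(* Imported again because all_classical shadows some of their lemma names. *)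
From mathcomp Require Import fintype finset ring lra zify.

Set Implicit Arguments.
Unset Strict Implicit.
Unset Printing Implicit Defensive.

Import Order.TTheory GRing.Theory Num.Theory.

Local Open Scope ring_scope.

(** * Averages and the Cauchy-Schwarz cube bound *)

Section Average.
Variable R : realFieldType.

(** Over an empty type the value is 0, because [0^-1 = 0]; this is why several lemmas below hold
    without inhabitation. *)
Definition avg (T : finType) (f : T -> R) : R := (\sum_x f x) / #|T|%:R.

Lemma eq_avg (T : finType) (f g : T -> R) : f =1 g -> avg f = avg g.
Proof. by move=> e; rewrite /avg (eq_bigr g). Qed.

Lemma ler_avg (T : finType) (f g : T -> R) :
  (forall x, f x <= g x) -> avg f <= avg g.
Proof. by move=> le; rewrite ler_wpM2r ?invr_ge0 // ler_sum. Qed.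

Lemma avg_ge0 (T : finType) (f : T -> R) : (forall x, 0 <= f x) -> 0 <= avg f.
Proof. by move=> le; rewrite mulr_ge0 ?invr_ge0 // sumr_ge0. Qed.

Lemma ler_norm_avg (T : finType) (f : T -> R) :
  `|avg f| <= avg (fun x => `|f x|).
Proof.
by rewrite normrM normfV normr_nat ler_wpM2r ?invr_ge0 // ler_norm_sum.
Qed.

Lemma avgZ (T : finType) a (f : T -> R) : avg (fun x => a * f x) = a * avg f.
Proof. by rewrite /avg -mulr_sumr mulrA. Qed.

Lemma avgD (T : finType) (f g : T -> R) :
  avg (fun x => f x + g x) = avg f + avg g.
Proof. by rewrite /avg big_split mulrDl. Qed.

Lemma avg_sum (T I : finType) (f : I -> T -> R) :
  avg (fun x => \sum_i f i x) = \sum_i avg (f i).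
Proof. by rewrite /avg exchange_big /= mulr_suml. Qed.

Lemma avg_const (T : finType) a : (0 < #|T|)%N -> avg (fun _ : T => a) = a.
Proof.
by move=> T0; rewrite /avg sumr_const -(mulr_natr a) mulfK // pnatr_eq0 -lt0n.
Qed.

Lemma avg_const_le (T : finType) a : 0 <= a -> avg (fun _ : T => a) <= a.
Proof.
move=> a0; have [T0|] := posnP #|T|; last by move=> /avg_const ->.
by rewrite /avg T0 invr0 mulr0.
Qed.

Lemma exists_le_avg (T : finType) (f : T -> R) :
  (0 < #|T|)%N -> exists x, f x <= avg f.
Proof.
move=> T0; apply/existsP; apply: contraT => /existsPn lt.
have T0' : 0 < #|T|%:R :> R by rewrite ltr0n.
have [x0 _] := card_gt0P T0.
suff: \sum_(x : T) avg f < \sum_x f x.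
  by rewrite sumr_const -[_ *+ _]mulr_natr /avg mulfVK ?ltxx // gt_eqF.
apply: ltr_sum; first by apply/hasP; exists x0; rewrite ?mem_index_enum.
by move=> x _; rewrite ltNge lt.
Qed.

Lemma avg_exchange (T U : finType) (f : T -> U -> R) :
  avg (fun x => avg (f x)) = avg (fun y => avg (f^~ y)).
Proof.
by rewrite /avg -!mulr_suml exchange_big /= -!mulrA [_^-1 * _^-1]mulrC.
Qed.

Lemma avg_pair (T U : finType) (f : T * U -> R) :
  avg f = avg (fun x => avg (fun y => f (x, y))).
Proof.
rewrite /avg -mulr_suml pair_bigA /= card_prod natrM invfM.
rewrite [_^-1 * _^-1]mulrC mulrA.
by congr (_ / _ / _); apply: eq_bigr => -[].
Qed.

Lemma avg_bij (T U : finType) (h : T -> U) (f : U -> R) :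
  bijective h -> avg f = avg (fun x => f (h x)).
Proof.
move=> bh; rewrite /avg (bij_eq_card bh); congr (_ / _).
exact/reindex/onW_bij.
Qed.

Lemma avg_sqr_le (T : finType) (f : T -> R) :
  avg f ^+ 2 <= avg (fun x => f x ^+ 2).
Proof.
have [T0|T0] := posnP #|T|.
  by rewrite /avg T0 invr0 !mulr0 expr0n.
have : 0 <= avg (fun x => (f x - avg f) ^+ 2).
  by apply: avg_ge0 => x; exact: sqr_ge0.
rewrite (@eq_avg _ _ (fun x => f x ^+ 2 + (- (2 * avg f) * f x + avg f ^+ 2))).
  by rewrite avgD avgD avgZ avg_const // expr2; lra.
by move=> x; ring.
Qed.

Lemma avg_exp2_le (T : finType) (f : T -> R) k :
  avg f ^+ (2 ^ k) <= avg (fun x => f x ^+ (2 ^ k)).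
Proof.
elim: k f => [|k IH] f; first by rewrite expn0 expr1.
rewrite expnS exprM (@eq_avg _ (fun x => f x ^+ _) (fun x =>
  (f x ^+ 2) ^+ (2 ^ k))); last first.
  by move=> x /=; rewrite exprM.
apply: le_trans (IH _); apply: lerXn2r; rewrite ?nnegrE ?sqr_ge0 //.
- by apply: avg_ge0 => x; exact: sqr_ge0.
- exact: avg_sqr_le.
Qed.

Lemma avg_mul (T U : finType) (f : T -> R) (g : U -> R) :
  avg f * avg g = avg (fun p : T * U => f p.1 * g p.2).
Proof.
rewrite avg_pair /= [RHS](@eq_avg _ _ (fun x => avg g * f x)).
  by rewrite avgZ mulrC.
by move=> x; rewrite avgZ mulrC.
Qed.

End Average.

Section Cube.

Definition fcons (T : Type) (k : nat) (y : T) (t : {ffun 'I_k -> T}) :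
    {ffun 'I_k.+1 -> T} := [ffun i => oapp t y (unlift ord0 i)].

Lemma fcons0 T k y (t : {ffun 'I_k -> T}) : fcons y t ord0 = y.
Proof. by rewrite ffunE unlift_none. Qed.

Lemma fconsS T k y (t : {ffun 'I_k -> T}) i : fcons y t (lift ord0 i) = t i.
Proof. by rewrite ffunE liftK. Qed.

Lemma fcons_bij (T : Type) k :
  bijective (fun p : T * {ffun 'I_k -> T} => fcons p.1 p.2).
Proof.
exists (fun z : {ffun 'I_k.+1 -> T} =>
  (z ord0, [ffun j : 'I_k => z (lift ord0 j)])) => [[y t]|z].
  by rewrite fcons0; congr pair; apply/ffunP => j; rewrite ffunE fconsS.
by apply/ffunP => i; rewrite ffunE; case: unliftP => [j ->|->] //=;
  rewrite ffunE.
Qed.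

Variable R : realFieldType.

Lemma avg_fcons (T : finType) k (f : {ffun 'I_k.+1 -> T} -> R) :
  avg f = avg (fun y => avg (fun t => f (fcons y t))).
Proof. by rewrite (avg_bij _ (fcons_bij T k)) avg_pair. Qed.

Lemma ffun_ord0 (T : Type) (t t' : {ffun 'I_0 -> T}) : t = t'.
Proof. by apply/ffunP => -[]. Qed.

Lemma avg_ffun0 (T : finType) (f : {ffun 'I_0 -> T} -> R) t : avg f = f t.
Proof.
rewrite (@eq_avg _ _ _ (fun=> f t)); last by move=> u; rewrite (ffun_ord0 u t).
by apply: avg_const; rewrite card_ffun card_ord.
Qed.

Definition vertex (Y : Type) (k : nat) (w : {ffun 'I_k -> Y * Y})
    (u : {ffun 'I_k -> bool}) : {ffun 'I_k -> Y} :=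
  [ffun i => if u i then (w i).2 else (w i).1].

Lemma vertex_fcons (Y : Type) k (p : Y * Y) b (w : {ffun 'I_k -> Y * Y}) u :
  vertex (fcons p w) (fcons b u) = fcons (if b then p.2 else p.1) (vertex w u).
Proof.
apply/ffunP => i; rewrite ffunE; case: (unliftP ord0 i) => [j ->|->].
  by rewrite !fconsS ffunE.
by rewrite !fcons0.
Qed.

(** Induction on [k]. Each Cauchy-Schwarz step doubles one variable into a pair and removes the
    factor that ignores this variable; the remaining factors get multiplied in pairs and keep their
    bounds and independence. The factor [chi0], which ignores [x], only costs the final absolute
    value. *)
Lemma cube_bound (X Y : finType) (k : nat) (F : X -> {ffun 'I_k -> Y} -> R)
    (chi0 : {ffun 'I_k -> Y} -> R) (chi : 'I_k -> X -> {ffun 'I_k -> Y} -> R) :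
  (forall y, `|chi0 y| <= 1) ->
  (forall i x y, `|chi i x y| <= 1) ->
  (forall i x (y y' : {ffun 'I_k -> Y}), (forall j, j != i -> y j = y' j) ->
    chi i x y = chi i x y') ->
  avg (fun y => avg (fun x => F x y * (chi0 y * \prod_i chi i x y))) ^+ (2 ^ k)
  <= avg (fun w => `|avg (fun x => \prod_u F x (vertex w u))|).
Proof.
elim: k F chi0 chi => [|k IH] F chi0 chi chi0_le chi_le chi_indep.
  pose t0 : {ffun 'I_0 -> Y} := [ffun i : 'I_0 =>
    False_rect _ (notF (ltn_ord i))].
  pose w0 : {ffun 'I_0 -> Y * Y} := [ffun i : 'I_0 =>
    False_rect _ (notF (ltn_ord i))].
  pose u0 : {ffun 'I_0 -> bool} := [ffun i => true].
  rewrite (avg_ffun0 _ t0) (avg_ffun0 _ w0) expr1.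
  rewrite (@eq_avg _ _ _ (fun x => chi0 t0 * F x t0)); last first.
    by move=> x; rewrite big_ord0 mulr1 mulrC.
  rewrite (@eq_avg _ _ (fun x => \prod_u _) (fun x => F x t0)); last first.
    move=> x; rewrite (big_pred1 u0) => [|u];
      last by rewrite /= (ffun_ord0 u u0) eqxx.
    by rewrite (ffun_ord0 (vertex _ _) t0).
  by rewrite avgZ (le_trans (ler_norm _)) // normrM ler_piMl.
pose g x (t : {ffun 'I_k -> Y}) y :=
  F x (fcons y t) * (chi0 (fcons y t) *
    \prod_i chi (lift ord0 i) x (fcons y t)).
(* [chi ord0] does not depend on the first coordinate, so Cauchy-Schwarz over
   the other variables removes it. *)
have sq_le :
    avg (fun y => avg (fun x => F x y * (chi0 y * \prod_i chi i x y))) ^+ 2 <=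
    avg (fun p : Y * Y =>
      avg (fun t => avg (fun x => g x t p.1 * g x t p.2))).
  rewrite avg_fcons avg_exchange.
  apply: (@le_trans _ _ (avg (fun t => avg (fun x => avg (g x t) ^+ 2)))).
    apply: le_trans (avg_sqr_le _) _; apply: ler_avg => t.
    rewrite avg_exchange; apply: le_trans (avg_sqr_le _) _; apply: ler_avg => x.
    have [c c_le cE] :
        exists2 c, `|c| <= 1 & forall y, chi ord0 x (fcons y t) = c.
      case: (pickP (@predT Y)) => [y0 _|Y0]; last first.
        by exists 0 => [|y]; [rewrite normr0 ler01 | have := Y0 y].
      exists (chi ord0 x (fcons y0 t)) => // y; apply: chi_indep => j.
      by case: (unliftP ord0 j) => [j' ->|->]; rewrite ?fconsS // eqxx.
    rewrite (@eq_avg _ _ _ (fun y => c * g x t y)); last first.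
      by move=> y; rewrite big_ord_recl cE /g; ring.
    rewrite avgZ exprMn ler_piMl ?sqr_ge0 //.
    by rewrite -real_normK ?num_real // expr_le1.
  rewrite le_eqVlt; apply/orP; left; apply/eqP.
  rewrite [RHS]avg_exchange; apply: eq_avg => t.
  by rewrite avg_exchange; apply: eq_avg => x; rewrite expr2 avg_mul.
rewrite expnS exprM; apply: le_trans (lerXn2r _ _ _ sq_le) _;
  rewrite ?nnegrE ?sqr_ge0 //.
  exact: le_trans (sqr_ge0 _) sq_le.
(* Convexity moves the remaining power inside the average over the pair, which becomes the first
   edge of the cube and stays fixed from here on. *)
apply: le_trans (avg_exp2_le _ _) _; rewrite [leRHS]avg_fcons;
  apply: ler_avg => -[y y'] /=.
pose F' x t := F x (fcons y t) * F x (fcons y' t).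
pose c0 t := chi0 (fcons y t) * chi0 (fcons y' t).
pose c i x t := chi (lift ord0 i) x (fcons y t) *
  chi (lift ord0 i) x (fcons y' t).
have := IH F' c0 c.
rewrite (_ : avg _ = avg (fun t => avg (fun x => g x t y * g x t y')));
  last first.
  apply: eq_avg => t; apply: eq_avg => x; rewrite /g /c big_split /= /F' /c0;
    ring.
move=> h; apply: le_trans (h _ _ _) _ => [t|i x t|i x t t' e|].
- by rewrite normrM mulr_ile1.
- by rewrite normrM mulr_ile1.
- have e' y0 j : j != lift ord0 i -> fcons y0 t j = fcons y0 t' j.
    case: (unliftP ord0 j) => [j' ->|-> _]; last by rewrite !fcons0.
    by rewrite (inj_eq lift_inj) !fconsS; exact: e.
  by congr (_ * _); apply: chi_indep => j /e'.
apply: ler_avg => w; rewrite le_eqVlt; apply/orP; left; apply/eqP.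
congr `|_|; apply: eq_avg => x.
(* The vertices of the larger cube split according to their choice on the first edge. *)
rewrite [RHS](reindex
  (fun p : bool * {ffun 'I_k -> bool} => fcons p.1 p.2)) /=; last first.
  exact/onW_bij/fcons_bij.
rewrite -(pair_bigA _ (fun b u =>
  F x (vertex (fcons (y, y') w) (fcons b u)))) /=.
rewrite big_bool /= -big_split; apply: eq_bigr => u _.
by rewrite !vertex_fcons /F' mulrC.
Qed.

End Cube.

(** * A dual polynomial for OR *)

Section Dual.
Variable R : realFieldType.

(** Lagrange interpolation at the [n] nodes reproduces [q]; the sum is its coefficient of degree
    [n - 1], which is 0. *)
Lemma divided_difference (n : nat) (x : nat -> R) (q : {poly R}) :
  injective x -> (size q < n)%N ->
  \sum_(i < n) q.[x i] / \prod_(j < n | j != i) (x i - x j) = 0.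
Proof.
move=> x_inj size_q; have n0 : (0 < n)%N by exact: leq_ltn_trans size_q.
have := congr1 (fun p : {poly R} => p`_n.-1)
  (lagrange_gen n0 x_inj (ltnW size_q)).
rewrite nth_default; last by rewrite -ltnS prednK.
rewrite coef_sum => e; rewrite [RHS]e; apply: eq_bigr => i _.
rewrite lagrangeE //= mulrA -polyCM coefCM horner_prod.
under [X in _ = _ / X * _]eq_bigr do rewrite hornerXsubC.
rewrite -[LHS]mulr1; congr (_ * _).
set p := \prod_(j < n | _) ('X - _).
have sz : size p = n.
  rewrite /p -big_filter size_prod_XsubC size_filter -sum1_count.
  by rewrite (sum1_card (predC1 i)) cardC1 card_ord prednK.
rewrite -[X in _`_X.-1]sz -lead_coefE; apply/esym/eqP; rewrite -monicE.
by apply: monic_prod => j _; exact: monicXsubC.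
Qed.

Definition falling (b : nat) : {poly R} := \prod_(i < b) ('X - i%:R%:P).

Lemma size_falling b : size (falling b) = b.+1.
Proof.
by rewrite size_prod_XsubC [index_enum _]unlock /= -enumT size_enum_ord.
Qed.

Lemma horner_falling b t : (falling b).[t%:R] = (t ^_ b)%:R.
Proof.
rewrite horner_prod ffact_prod natr_prod.
have [tb|bt] := ltnP t b.
  rewrite (bigD1 (Ordinal tb)) //= [RHS](bigD1 (Ordinal tb)) //=.
  by rewrite !hornerE subnn subrr !mul0r.
apply: eq_bigr => i _; rewrite !hornerE natrB //.
exact: leq_trans (ltnW (ltn_ord i)) bt.
Qed.

(* ['C(m - a, t - b) / 'C(m, t)] as a polynomial of degree [a] in [t]. *)
Definition bin_ratio (m a b : nat) : {poly R} :=
  ((m ^_ a)%:R^-1)%:P * (falling b * (falling (a - b) \Po (m%:R%:P - 'X))).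

Lemma size_bin_ratio m a b : (b <= a)%N -> (size (bin_ratio m a b) <= a.+1)%N.
Proof.
move=> ba; rewrite /bin_ratio mul_polyC;
  apply: leq_trans (size_scale_leq _ _) _.
apply: leq_trans (size_polyMleq _ _) _; rewrite size_falling.
have sX : (size (m%:R%:P - 'X : {poly R})%R <= 2)%N.
  by rewrite -opprB size_polyN size_XsubC.
have := size_comp_poly_leq (falling (a - b)) (m%:R%:P - 'X : {poly R});
  rewrite size_falling /=.
move: sX; move: (size _) (size _) => s1 s2; nia.
Qed.

(** Multiplied by [(t - b)! (m - t - (a - b))!], both sides equal [m!]. If [m - t < a - b], both
    sides are 0. *)
Lemma bin_ffact_ratio m a b t : (b <= a)%N -> (a <= m)%N -> (b <= t <= m)%N ->
  ('C(m, t) * (t ^_ b * (m - t) ^_ (a - b)) = 'C(m - a, t - b) * m ^_ a)%N.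
Proof.
move=> ba am /andP[bt tm].
have [lt|le] := ltnP (m - t) (a - b).
  by rewrite (ffact_small lt) !muln0 bin_small // ; lia.
have f1 := bin_fact tm.
have f2 := ffact_fact bt.
have f3 := ffact_fact le.
have f4 : ('C(m - a, t - b) * ((t - b)`! * (m - t - (a - b))`!) = (m - a)`!)%N.
  by rewrite -(@bin_fact (m - a) (t - b)); [congr (_ * (_ * _`!))%N|]; lia.
have f5 := ffact_fact am.
have pos : (0 < (t - b)`! * (m - t - (a - b))`!)%N.
  by rewrite muln_gt0 !fact_gt0.
apply/eqP; rewrite -(eqn_pmul2r pos); apply/eqP.
transitivity m`!; first by rewrite -f1 -f2 -f3; ring.
by rewrite -f5 -f4; ring.
Qed.

Lemma horner_bin_ratio m a b t : (b <= a)%N -> (a <= m)%N -> (b <= t <= m)%N ->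
  ('C(m, t))%:R * (bin_ratio m a b).[t%:R] = ('C(m - a, t - b))%:R.
Proof.
move=> ba am /andP[bt tm].
have m0 : (m ^_ a)%:R != 0 :> R by rewrite pnatr_eq0 -lt0n ffact_gt0.
have := bin_ffact_ratio ba am; move=> /(_ t); rewrite bt tm => /(_ isT) e.
rewrite hornerM hornerC hornerM horner_comp hornerD hornerC hornerN hornerX.
rewrite horner_falling -natrB // horner_falling.
by rewrite mulrCA -!natrM e natrM mulrC mulfK.
Qed.

Lemma horner_bin_ratio0 m a b t : (t < b)%N -> (bin_ratio m a b).[t%:R] = 0.
Proof.
move=> tb; rewrite hornerM hornerM horner_falling (ffact_small tb).
by rewrite mul0r mulr0.
Qed.

(** The divided difference of [bin_ratio m a b], of degree at most [a < n - 1]. The ratio of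
    binomials is the probability that a random string of weight [x i] has ones at [b] prescribed
    places and zeros at [a - b] others. *)
Lemma sum_bin_nodes (n m a b : nat) (x : nat -> nat) :
  injective x -> (forall i, (i < n)%N -> (x i <= m)%N) ->
  (b <= a)%N -> (a <= m)%N -> (a.+1 < n)%N ->
  \sum_(i < n)
     (if (b <= x i)%N
      then ('C(m - a, x i - b))%:R / ('C(m, x i))%:R else 0) /
     \prod_(j < n | j != i) ((x i)%:R - (x j)%:R) = 0 :> R.
Proof.
move=> x_inj x_le ba am an.
have x_inj' : injective (fun i => (x i)%:R : R).
  by move=> i j /eqP; rewrite eqr_nat => /eqP /x_inj.
have := divided_difference x_inj' (leq_ltn_trans (size_bin_ratio m ba) an).
move=> e; rewrite -[RHS]e; apply: eq_bigr => i _; congr (_ / _).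
case: leqP => [bx|xb]; last by rewrite horner_bin_ratio0.
rewrite -(horner_bin_ratio ba am); last by rewrite bx x_le.
by rewrite mulrC mulKf // pnatr_eq0 -lt0n bin_gt0 x_le.
Qed.
End Dual.

(** * Products and sums over quadratically spaced nodes *)

Section Nodes.

(** The right-hand side is nondecreasing in [i], with equality at [i = 0]. *)
Lemma fact_sqr_le h i : (i <= h)%N -> (h`! ^ 2 <= (h - i)`! * (h + i)`!)%N.
Proof.
elim: i => [|i IH] ih; first by rewrite subn0 addn0 mulnn.
apply: leq_trans (IH (ltnW ih)) _.
have e : (h - i = (h - i.+1).+1)%N by lia.
rewrite e addnS !factS mulnAC mulnC leq_mul2l leq_mul2r.
by apply/orP; right; apply/orP; right; lia.
Qed.

Lemma prod_below i l : (l <= i)%N ->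
  ((\prod_(j < l) ((i - j) * (i + j + 2))) * ((i - l)`! * i.+1`!) =
    i`! * (i + l).+1`!)%N.
Proof.
elim: l => [|l IH] li; first by rewrite big_ord0 mul1n subn0 addn0.
rewrite big_ord_recr /= !addnS addn0 [(i + l).+2`!]factS.
rewrite [RHS]mulnCA -(IH (ltnW li)).
have -> : (i - l = (i - l.+1).+1)%N by lia.
rewrite (factS (i - l.+1)); ring.
Qed.

(** This is the factored form of [|(i + 1)^2 - (j + 1)^2|]: at least one of the two truncated
    differences is 0. *)
Definition gap i j := (((i - j) + (j - i)) * (i + j + 2))%N.

(** The differences contribute [i! (h - 1 - i)!] and the sums contribute [(h + i + 1)! / (i + 1)!],
    from which the omitted index [j = i] removes [2 (i + 1)]. *)
Lemma prod_gap h i : (i < h)%N ->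
  ((\prod_(j < h | j != i :> nat) gap i j) * (2 * i.+1 ^ 2) =
    (h - i.+1)`! * (h + i.+1)`!)%N.
Proof.
elim: h => // h IH; rewrite ltnS leq_eqVlt => /predU1P [->|ih].
  rewrite big_mkcond big_ord_recr /= eqxx muln1 subnn fact0 mul1n.
  rewrite (eq_bigr (fun j : 'I_h => (h - j) * (h + j + 2))%N); last first.
    by move=> j _; rewrite ltn_eqF ?ltn_ord // /gap (eqP (ltnW (ltn_ord j)))
      addn0.
  have := prod_below (leqnn h); rewrite subnn fact0 mul1n => e.
  have p : (0 < h`!)%N by exact: fact_gt0.
  apply/eqP; rewrite -(eqn_pmul2r p); apply/eqP.
  rewrite addSn addnS [(h + h).+2`!]factS -mulnA [RHS]mulnC [RHS]mulnCA -e
    factS; ring.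
rewrite big_mkcond big_ord_recr /= gtn_eqF // -big_mkcond /= mulnAC IH //.
rewrite addSn subSS factS.
have -> : (h - i = (h - i.+1).+1)%N by lia.
rewrite factS /gap (eqP (ltnW ih)).
have -> : (h - i = (h - i.+1).+1)%N by lia.
ring.
Qed.

Lemma prod_succ_sqr h i : (i < h)%N ->
  ((\prod_(j < h | j != i :> nat) j.+1 ^ 2) * i.+1 ^ 2 = h`! ^ 2)%N.
Proof.
move=> ih; rewrite fact_prod big_add1 big_mkord -[RHS]mulnn -big_split /=.
by rewrite mulnC [RHS](bigD1 (Ordinal ih)) //=.
Qed.

(** Up to powers of 25, this compares the distances to the other quadratic nodes from node 0 and
    from node [i + 2]. *)
Lemma prod_succ_sqr_le_gap h i : (i < h)%N ->
  (\prod_(j < h | j != i :> nat) j.+1 ^ 2 <=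
    2 * \prod_(j < h | j != i :> nat) gap i j)%N.
Proof.
move=> ih; have p : (0 < i.+1 ^ 2)%N by [].
rewrite -(leq_pmul2r p) prod_succ_sqr // -mulnA [(_ ^ 2)%N in leqRHS]lock
  mulnCA -lock prod_gap //.
exact: fact_sqr_le.
Qed.

(** The subtracted term makes the sum telescope; only the bound [1 / 6] matters afterwards. *)
Lemma sum_node_ratio_le (R : realFieldType) h :
  \sum_(i < h) 2 / (25 * i.+1%:R ^+ 2 - 1) <= 1 / 6 - (12 * h%:R + 6)^-1 :> R.
Proof.
elim: h => [|h IH]; first by rewrite big_ord0 mulr0 add0r; lra.
rewrite big_ord_recr /=; apply: le_trans (lerD IH (lexx _)) _.
rewrite -[h.+1]addn1 natrD; have : 0 <= h%:R :> R by [].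
move: (h%:R) => z z0.
have -> : 1 / 6 - (12 * (z + 1) + 6)^-1 = 1 / 6 - (12 * z + 6)^-1 +
    12 / ((12 * z + 6) * (12 * (z + 1) + 6)).
  by field; rewrite !gt_eqF //; lra.
rewrite lerD2l ler_pdivrMr; last by nra.
rewrite mulrAC ler_pdivlMr; last by nra.
nra.
Qed.

End Nodes.

(* The squares make the weight at node [i] decay like [1 / i ^ 2], and the factor
   25 brings the total weight outside {0, 1} below 1/6 of the weight at 0. *)
Definition node i := match i with 0 => 0 | 1 => 1 | j.+2 => 25 * j.+1 ^ 2 end%N.

Lemma node_inj : injective node.
Proof. by move=> [|[|i]] [|[|j]] //=; nia. Qed.

Lemma node_le h i : (i < h.+2)%N -> (node i <= maxn 1 (25 * h ^ 2))%N.
Proof. case: i => [|[|i]] //=; nia. Qed.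

Section DualOR.
Variables (R : realFieldType) (h : nat).

Definition node_gap i : R :=
  \prod_(j < h.+2 | j != i :> nat) ((node i)%:R - (node j)%:R).

Lemma normr_node_gap0 : `|node_gap 0| = (\prod_(j < h) (25 * j.+1 ^ 2))%:R.
Proof.
rewrite /node_gap big_mkcond 2!big_ord_recl /= !mul1r sub0r normrM normrN1
  mul1r.
by rewrite normr_prod natr_prod; apply: eq_bigr => j _;
  rewrite sub0r normrN normr_nat.
Qed.

(** Nodes 0 and 1 give the first two factors; each of the [h - 1] other nodes gives
    [25 * gap i j]. *)
Lemma normr_node_gapSS i : (i < h)%N ->
  `|node_gap i.+2| = ((25 * i.+1 ^ 2) * (25 * i.+1 ^ 2 - 1) *
     (25 ^ h.-1 * \prod_(j < h | j != i :> nat) gap i j))%:R.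
Proof.
move=> ih; rewrite /node_gap big_mkcond 2!big_ord_recl /= subr0 !normrM
  normr_nat.
rewrite -natrB; last by nia.
rewrite normr_nat mulrA -natrM [RHS]natrM; congr (_ * _).
rewrite -big_mkcond normr_prod.
have -> : (25 ^ h.-1 = \prod_(j < h | j != i :> nat) 25)%N.
  rewrite prod_nat_const; congr (_ ^ _)%N.
  by rewrite (eq_card (B := predC1 (Ordinal ih))) ?cardC1 ?card_ord.
rewrite -big_split natr_prod; apply: eq_bigr => j _.
rewrite /gap; have [le|lt] := leqP j i.
- rewrite -natrB /=; last by nia.
  by rewrite normr_nat; congr (_%:R); nia.
- rewrite distrC -natrB /=; last by nia.
  by rewrite normr_nat; congr (_%:R); nia.
Qed.

Lemma node_gap_neq0 i : node_gap i != 0.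
Proof.
apply/prodf_neq0 => j ji; rewrite subr_eq0 eqr_nat; apply: contra ji => /eqP e.
by rewrite (node_inj e).
Qed.

Lemma inv_node_gap_le i : (i < h)%N ->
  `|node_gap i.+2|^-1 <= `|node_gap 0|^-1 * (2 / (25 * i.+1%:R ^+ 2 - 1)).
Proof.
move=> ih; have p0 : 0 < `|node_gap 0| by rewrite normr_gt0 node_gap_neq0.
have p1 : 0 < `|node_gap i.+2| by rewrite normr_gt0 node_gap_neq0.
have i1 : 1 <= i.+1%:R :> R by rewrite ler1n.
have q : 0 < 25 * i.+1%:R ^+ 2 - 1 :> R by nra.
rewrite -div1r ler_pdivrMr // -!mulrA ler_pdivlMl // mulr1 mulrCA ler_pdivlMl
  //.
have -> : 25 * i.+1%:R ^+ 2 - 1 = (25 * i.+1 ^ 2 - 1)%:R :> R.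
  by rewrite natrB ?natrM ?natrX //; nia.
rewrite normr_node_gap0 normr_node_gapSS // -!natrM ler_nat.
rewrite (bigD1 (Ordinal ih)) //= big_split /= prod_nat_const.
rewrite (eq_card (B := predC1 (Ordinal ih))) // cardC1 card_ord.
have := prod_succ_sqr_le_gap ih.
move: (\prod_(j < h | _) gap i j)%N => G.
rewrite (eq_bigl (fun j : 'I_h => j != i :> nat)) //.
move: (\prod_(j < h | _) _)%N => P PG.
move: (25 * i.+1 ^ 2)%N (25 ^ h.-1)%N => a c.
rewrite [X in (_ <= X)%N](_ : _ = (a - 1) * (a * (c * (2 * G))))%N;
  last by ring.
by rewrite !leq_mul2l PG !orbT.
Qed.

Definition node_mass : R := \sum_(i < h.+2) `|node_gap i|^-1.

Lemma node_mass_gt0 : 0 < node_mass.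
Proof.
rewrite /node_mass big_ord_recl ltr_pwDl //; last first.
  by apply: sumr_ge0 => i _; rewrite invr_ge0.
by rewrite invr_gt0 normr_gt0 node_gap_neq0.
Qed.

(** The inverse gaps sum to 0, being a divided difference of the constant 1. Hence node 1 weighs at
    most as much as node 0 plus the rest, and the rest weighs at most [1 / 6] of node 0. The total
    is at most [7 / 3 <= 12 / 5] times the weight of node 0. *)
Lemma node_mass_le :
  node_mass <= 12 / 5 * `|node_gap 0|^-1.
Proof.
rewrite /node_mass.
have aux (v0 v1 s t : R) : `|s| <= t -> t <= `|v0| * (1 / 6) ->
    v0 + (v1 + s) = 0 -> `|v0| + (`|v1| + t) <= 12 / 5 * `|v0|.
  move=> h1 h2 h3; have h4 : `|v1| <= `|v0| + `|s|.
    have -> : v1 = - (v0 + s) by lra.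
    by rewrite normrN ler_normD.
  have := normr_ge0 v0; lra.
have : \sum_(i < h.+2) (node_gap i)^-1 = 0.
  have x_inj : injective (fun i => (node i)%:R : R).
    by move=> i j /eqP; rewrite eqr_nat => /eqP /node_inj.
  have := @divided_difference R h.+2 _ 1 x_inj;
    rewrite size_poly1 => /(_ isT) e.
  rewrite -[RHS]e; apply: eq_bigr => i _; by rewrite hornerC div1r.
have : \sum_(i < h) (`|node_gap i.+2|^-1 : R) <= `|node_gap 0|^-1 * (1 / 6).
  have p0 : 0 <= `|node_gap 0|^-1 by rewrite invr_ge0.
  apply: le_trans (_ : `|node_gap 0|^-1 *
    \sum_(i < h) 2 / (25 * i.+1%:R ^+ 2 - 1) <= _).
    by rewrite mulr_sumr ler_sum // => i _; exact: inv_node_gap_le.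
  rewrite ler_wpM2l //; apply: le_trans (sum_node_ratio_le _ _) _.
  by rewrite gerBl invr_ge0 addr_ge0 ?mulr_ge0.
have : `|\sum_(i < h) (node_gap i.+2)^-1| <=
  \sum_(i < h) (`|node_gap i.+2|^-1 : R).
  apply: le_trans (ler_norm_sum _ _ _) _.
  by rewrite le_eqVlt; apply/orP; left; apply/eqP/eq_bigr => i _;
    rewrite normfV.
rewrite !big_ord_recl /=.
rewrite -!normfV.
exact: aux.
Qed.

(** The divided-difference functional, normalised to total mass 1 and signed so as to be positive at
    0. Dividing by ['C(m, t)] spreads the mass of a node evenly over the strings of Hamming weight
    [t]; the sum has at most one term. *)
Definition dual_weight m t : R :=
  Num.sg (node_gap 0) * node_mass^-1 *
  \sum_(i < h.+2 | node i == t) (node_gap i)^-1 / ('C(m, t))%:R.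

Lemma node_le_m m i : (25 * h ^ 2 <= m)%N -> (0 < m)%N -> (i < h.+2)%N ->
  (node i <= m)%N.
Proof. by move=> hm m0 /node_le; lia. Qed.

(** Orthogonality to the indicator of any assignment with [b] ones to [a <= h] coordinates, where
    [j] counts the ones among the others. The hypotheses on [m] keep all nodes in [[0, m]], node 1
    included when [h = 0]. *)
Lemma sum_dual_weight m a b : (25 * h ^ 2 <= m)%N -> (0 < m)%N ->
  (b <= a)%N -> (a <= h)%N ->
  \sum_(j < (m - a).+1) ('C(m - a, j))%:R * dual_weight m (b + j)%N = 0.
Proof.
move=> hm m0 ba ah; have am : (a <= m)%N by nia.
have := @sum_bin_nodes R h.+2 m a b _ node_inj (fun i =>
  @node_le_m m i hm m0) ba am ah.
move/(congr1 (fun x => Num.sg (node_gap 0) * node_mass^-1 * x)).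
rewrite mulr0 => e; rewrite -[RHS]e.
under eq_bigr do rewrite mulrCA.
rewrite -mulr_sumr; congr (_ * _).
under eq_bigr do rewrite big_mkcond mulr_sumr.
rewrite exchange_big; apply: eq_bigr => i _ /=.
have im := node_le_m hm m0 (ltn_ord i).
case: leqP => [bi|ib].
  have [lt|ge] := ltnP (node i - b) (m - a).+1.
    rewrite (bigD1 (Ordinal lt)) //= subnKC // eqxx big1 ?addr0 => [|j jn].
      by rewrite mulrCA mulrC.
    case: eqP => [e'|]; rewrite ?mulr0 //.
    by case/eqP: jn; apply: val_inj; rewrite /= e' addKn.
  rewrite bin_small // !mul0r big1 // => j _.
  by case: eqP => [e'|]; rewrite ?mulr0 //; have := ltn_ord j; lia.
rewrite mul0r big1 // => j _.
by case: eqP => [e'|]; rewrite ?mulr0 //; lia.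
Qed.

Lemma sum_norm_dual_weight m : (25 * h ^ 2 <= m)%N -> (0 < m)%N ->
  \sum_(j < m.+1) (('C(m, j))%:R * `|dual_weight m j| : R) <= 1.
Proof.
move=> hm m0. have A0 := node_mass_gt0.
apply: (@le_trans _ _ (node_mass^-1 * node_mass));
  last by rewrite mulVf ?gt_eqF.
rewrite {2}/node_mass.
apply: (@le_trans _ _ (\sum_(j < m.+1) node_mass^-1 *
  \sum_(i < h.+2 | node i == j) `|node_gap i|^-1)).
  apply: ler_sum => j _; rewrite /dual_weight !normrM normr_sg node_gap_neq0
    mul1r.
  rewrite (gtr0_norm (_ : 0 < node_mass^-1)) ?invr_gt0 // mulrCA ler_wpM2l
    ?invr_ge0 ?(ltW A0) //.
  have c0 : 0 < ('C(m, j))%:R :> R by rewrite ltr0n bin_gt0 -ltnS.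
  rewrite -mulr_suml normrM normfV normr_nat mulrCA mulfV ?gt_eqF // mulr1.
  apply: le_trans (ler_norm_sum _ _ _) _.
  by rewrite le_eqVlt; apply/orP; left; apply/eqP/eq_bigr => i _;
    rewrite normfV.
rewrite -mulr_sumr ler_wpM2l ?invr_ge0 ?(ltW A0) //.
under eq_bigr do rewrite big_mkcond.
rewrite exchange_big ler_sum // => i _ /=.
have im := node_le_m hm m0 (ltn_ord i).
rewrite -ltnS in im.
rewrite (bigD1 (Ordinal im)) //= eqxx big1 ?addr0 // => j jn.
by case: eqP => // e'; case/eqP: jn; apply: val_inj.
Qed.

(** The constant is the inverse of [12 / 5] from [node_mass_le]. *)
Lemma dual_weight0_ge m : 5 / 12 <= dual_weight m 0.
Proof.
rewrite /dual_weight. have A0 := node_mass_gt0.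
rewrite (big_pred1 ord0) => [|i]; last by rewrite /= (inj_eq node_inj _ 0%N).
rewrite bin0 divr1 mulrAC.
have -> : Num.sg (node_gap 0) * (node_gap 0)^-1 = `|node_gap 0|^-1.
  by rewrite -normfV [RHS]normrEsg sgrV.
rewrite ler_pdivlMr //; have := node_mass_le; lra.
Qed.

End DualOR.

(** * Expectations of products of masked dual polynomials *)

Section SetSums.
Variables (R : realFieldType) (V : finType).
Implicit Types (c e x D S B : {set V}) (L : seq {set V}).

Lemma sum_subset_card D (f : nat -> R) :
  \sum_(c : {set V} | c \subset D) f #|c| =
    \sum_(j < #|D|.+1) ('C(#|D|, j))%:R * f j.
Proof.
rewrite (partition_big (fun c => inord #|c| : 'I_#|D|.+1) xpredT) //=.
apply: eq_bigr => j _; rewrite -cards_draws mulrC -mulr_natr -sumr_const.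
rewrite mul1r mulr_sumr; apply: eq_big => [c|c].
  rewrite inE; case: (boolP (c \subset D)) => //= cD.
  by rewrite -val_eqE /= inordK // ltnS subset_leq_card.
by case/andP => cD /eqP <-; rewrite inordK ?mulr1 // ltnS subset_leq_card.
Qed.

Lemma sum_set_split D (G : {set V} -> R) :
  \sum_x G x = \sum_(e : {set V} | e \subset ~: D)
    \sum_(c : {set V} | c \subset D) G (c :|: e).
Proof.
rewrite (partition_big (fun x => x :\: D) (fun e => e \subset ~: D)) =>
  [|x _]; last first.
  by rewrite setDE subsetIr.
apply: eq_bigr => e eD.
have De : [disjoint D & e] by rewrite disjoint_sym -(setCK D) -subsets_disjoint.
rewrite (reindex_onto (fun c => c :|: e) (fun x => x :&: D)) /=; last first.
  by move=> x /eqP <-; rewrite setID.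
apply: eq_bigl => c.
have eI : e :&: D = set0 by apply/eqP; rewrite setI_eq0 disjoint_sym.
have eD' : e :\: D = e by apply/setDidPl; rewrite disjoint_sym.
rewrite setIUl eI setU0 setDUl eD'.
apply/andP/idP => [[_ /eqP <-]|cD]; first exact: subsetIr.
move: (cD); rewrite -setD_eq0 => /eqP ->; rewrite set0U eqxx.
by split=> //; apply/eqP/setIidPl.
Qed.

Variables (m d : nat) (w : nat -> R).
Hypothesis w_orth : forall a b, (b <= a)%N -> (a < d)%N ->
  \sum_(j < (m - a).+1) ('C(m - a, j))%:R * w (b + j)%N = 0.

(* Scaled so that the average of [`|psi S x|] over [x] is at most [1]. *)
Definition psi S x : R := 2 ^+ m * w #|x :&: S|.

Lemma card_mix S D c e : D \subset S -> c \subset D -> e \subset ~: D ->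
  #|(c :|: e) :&: S| = (#|e :&: S| + #|c|)%N.
Proof.
move=> DS cD eD; rewrite setIUl cardsU.
rewrite (setIidPl (subset_trans cD DS)) setIA.
have -> : c :&: e = set0.
  apply/eqP; rewrite setI_eq0 -[e]setCK -subsets_disjoint.
  by apply: subset_trans cD _; rewrite -setCS setCK.
by rewrite set0I cards0 subn0 addnC.
Qed.

(** Once [x] is fixed outside [D], the factor [H] is constant and the sum over the part inside [D]
    is an orthogonality relation with [a = #|S :\: D|]. *)
Lemma sum_psi_eq0 S D (H : {set V} -> R) : D \subset S -> #|S| = m ->
  (#|S :\: D| < d)%N -> (forall x, H (x :\: D) = H x) ->
  \sum_x psi S x * H x = 0.
Proof.
move=> DS Sm Dd HD; rewrite (sum_set_split D) big1 // => e eD.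
have HE c : c \subset D -> H (c :|: e) = H e.
  move=> cD; rewrite -HD setDUl; move: (cD); rewrite -setD_eq0 => /eqP ->.
  by rewrite set0U HD.
transitivity (2 ^+ m * H e *
  \sum_(c : {set V} | c \subset D) w (#|e :&: S| + #|c|)%N).
  rewrite mulr_sumr; apply: eq_bigr => c cD.
  by rewrite HE // /psi (card_mix DS) //; ring.
rewrite (sum_subset_card D (fun j => w (#|e :&: S| + j)%N)).
have aE : (m - #|S :\: D| = #|D|)%N.
  by rewrite cardsD (setIidPr DS) Sm subKn // -Sm subset_leq_card.
have le : (#|e :&: S| <= #|S :\: D|)%N.
  by apply: subset_leq_card; rewrite setDE setIC setIS.
by have := w_orth le Dd; rewrite aE => ->; rewrite mulr0.
Qed.

(** With [x] fixed outside [D], the inner sum of [|w|] has binomial coefficients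
    ['C(#|D|, j) <= 'C(m, b + j)], so the norm bound applies to it; the factor [2 ^ m] splits as
    [2 ^ #|S :\: D|] times [2 ^ #|D|]. *)
Lemma sum_norm_psi_le S D (H : {set V} -> R) :
  \sum_(j < m.+1) ('C(m, j))%:R * `|w j| <= 1 -> D \subset S -> #|S| = m ->
  (forall x, 0 <= H x) -> (forall x, H (x :\: D) = H x) ->
  \sum_x `|psi S x| * H x <= 2 ^+ #|S :\: D| * \sum_x H x.
Proof.
move=> w_norm DS Sm H0 HD; rewrite (sum_set_split D H).
rewrite (sum_set_split D (fun x => `|psi S x| * H x)) mulr_sumr.
have HE c e : c \subset D -> H (c :|: e) = H e.
  move=> cD; rewrite -HD setDUl; move: (cD); rewrite -setD_eq0 => /eqP ->.
  by rewrite set0U HD.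
apply: ler_sum => e eD.
rewrite (eq_bigr (fun c => 2 ^+ m * H e * `|w (#|e :&: S| + #|c|)%N|));
  last first.
  move=> c cD; rewrite HE // /psi (card_mix DS) // normrM.
  by rewrite ger0_norm ?exprn_ge0 //; ring.
rewrite [X in _ <= _ * X](eq_bigr (fun=> H e)); last by move=> c /HE.
rewrite -mulr_sumr (sum_subset_card D (fun j => `|w (#|e :&: S| + j)%N|)).
rewrite [X in _ <= _ * X](_ : _ = 2 ^+ #|D| * H e); last first.
  rewrite sumr_const -[H e *+ _]mulr_natl -natrX -card_powerset;
    congr (_%:R * _).
  by apply: eq_card => c; rewrite !inE.
have DSm : (#|S :\: D| + #|D| = m)%N.
  by rewrite cardsD (setIidPr DS) Sm subnK // -Sm subset_leq_card.
rewrite mulrA -exprD DSm ler_piMr ?mulr_ge0 ?exprn_ge0 //.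
apply: le_trans w_norm.
have le : (#|e :&: S| <= #|S :\: D|)%N.
  by apply: subset_leq_card; rewrite setDE setIC setIS.
move: le DSm; move: #|_| #|S :\: D| #|D| => b a D' ba aD.
(* Only the Hamming weights from [b] to [b + #|D|] occur; the terms below and above are
   discarded. *)
have -> : m.+1 = (b + (m - b).+1)%N by lia.
rewrite big_split_ord /= -[leLHS]add0r; apply: lerD.
  by apply: sumr_ge0 => j _; apply: mulr_ge0.
have -> : (m - b).+1 = (D'.+1 + (a - b))%N by lia.
rewrite big_split_ord /= -[leLHS]addr0; apply: lerD; last first.
  by apply: sumr_ge0 => j _; apply: mulr_ge0.
apply: ler_sum => j _ /=; rewrite ler_wpM2r // ler_nat.
have -> : m = (D' + a)%N by lia.
apply: (@leq_trans 'C(D' + b, b + j)); last by apply: leq_bin2l; lia.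
elim: b {ba} => [|b IH]; first by rewrite addn0.
by apply: leq_trans IH _; rewrite addnS binS leq_addl.
Qed.

Definition bigcup_seq L : {set V} := \bigcup_(S <- L) S.

(** This equals the sum of the sizes minus the size of the union. The recursive form suits adding
    one set at a time; [overlap_count] gives a symmetric one. *)
Fixpoint overlap L : nat :=
  if L is A :: L' then (#|A :&: bigcup_seq L'| + overlap L')%N else 0%N.

Lemma in_bigcup_seq L v : (v \in bigcup_seq L) = has (fun S => v \in S) L.
Proof.
rewrite /bigcup_seq; elim: L => [|S L IH]; first by rewrite big_nil inE.
by rewrite big_cons inE IH.
Qed.

Lemma card_bigcup_seq L : all (fun S => #|S| == m) L ->
  (#|bigcup_seq L| <= m * size L)%N.
Proof.
elim: L => [|S L IH] /=; first by rewrite /bigcup_seq big_nil cards0.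
move=> /andP[/eqP Sm /IH le]; rewrite /bigcup_seq big_cons mulnS.
apply: (@leq_trans (#|S| + #|bigcup_seq L|)%N); last by rewrite Sm leq_add2l.
by rewrite /bigcup_seq cardsU leq_subr.
Qed.

Lemma overlap_le L : all (fun S => #|S| == m) L -> (overlap L <= m * size L)%N.
Proof.
elim: L => [|S L IH] //= /andP[/eqP Sm /IH le]; rewrite mulnS leq_add //.
by rewrite -[leqRHS]Sm subset_leq_card // subsetIl.
Qed.

Lemma overlap_count L : overlap L = (\sum_v (count (fun S => v \in S) L).-1)%N.
Proof.
elim: L => [|S L IH] /=; first by rewrite big1.
rewrite IH -sum1_card big_mkcond -big_split; apply: eq_bigr => v _ /=.
rewrite inE in_bigcup_seq has_count; case: (v \in S) => //=.
by case: (count _ L).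
Qed.

(** The sets are peeled off one at a time, with [D] the points of the first set outside all later
    ones. *)
Lemma sum_prod_norm_psi_le L :
  \sum_(j < m.+1) ('C(m, j))%:R * `|w j| <= 1 -> all (fun S => #|S| == m) L ->
  \sum_x \prod_(S <- L) `|psi S x| <= 2 ^+ overlap L * 2 ^+ #|V|.
Proof.
move=> w_norm; elim: L => [|S L IH] /=.
  move=> _; under eq_bigr do rewrite big_nil.
  by rewrite expr0 mul1r sumr_const -natrX -cardsT -powersetT card_powerset
    cardsT.
move=> /andP[/eqP Sm /IH le].
under eq_bigr do rewrite big_cons.
have SD : S :\: (S :\: bigcup_seq L) = S :&: bigcup_seq L.
  by rewrite setDDr setDv set0U.
apply: le_trans (_ : 2 ^+ #|S :&: bigcup_seq L| *
  \sum_x \prod_(S <- L) `|psi S x| <= _).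
  rewrite -SD; apply: sum_norm_psi_le => //; first exact: subsetDl.
    by move=> x; apply: prodr_ge0.
  move=> x; rewrite big_seq [RHS]big_seq; apply: eq_bigr => B BL.
  rewrite /psi; congr (`|_ * w #|pred_of_set _| |).
  apply/setP => v; rewrite !inE; case vB: (v \in B); rewrite ?andbF // !andbT.
  by rewrite in_bigcup_seq (_ : has _ L) //; apply/hasP; exists B.
by rewrite exprD -mulrA ler_wpM2l // exprn_ge0.
Qed.

(** By averaging, some [S u] meets the union of the others in fewer than [d] points; its private
    points then serve as [D] in [sum_psi_eq0]. *)
Lemma sum_prod_psi_eq0 (U : finType) (S : U -> {set V}) :
  (forall u, #|S u| = m) ->
  (2 * overlap [seq S u | u <- enum U] < d * #|U|)%N ->
  \sum_x \prod_u psi (S u) x = 0.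
Proof.
move=> Sm lt; pose B u := S u :&: \bigcup_(u' | u' != u) S u'.
have /existsP [u Bu] : [exists u, #|B u| < d]%N.
  apply: contraLR lt => /existsPn ge; rewrite -leqNgt.
  apply: (@leq_trans (\sum_u #|B u|)%N).
    by rewrite mulnC -sum_nat_const leq_sum // => u _; rewrite leqNgt ge.
  (* A point lying in [c >= 2] of the sets counts [c] times here and [c - 1]
     times in the overlap. *)
  rewrite overlap_count big_distrr /=.
  under eq_bigr do rewrite -sum1_card big_mkcond.
  rewrite exchange_big leq_sum // => v _ /=.
  rewrite count_map -sum1_count big_enum_cond sum1dep_card.
  rewrite -big_mkcond sum1dep_card.
  set Q := (X in (X <= _)%N); set C := [set _ | _].
  have QC : (Q <= #|C|)%N.
    by apply: subset_leq_card; apply/subsetP => u; rewrite !inE => /andP[-> _].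
  have [C1|] := leqP #|C| 1; last by lia.
  rewrite (_ : Q = 0%N) //; apply: eq_card0 => u; apply/negbTE; rewrite inE;
    apply/negP => /setIP[vu].
  move=> /bigcupP [u' u'u vu']; move: C1; rewrite leqNgt => /negP; apply.
  by apply/card_gt1P; exists u, u'; rewrite !inE // eq_sym.
have Bd : S u :\: B u \subset S u by exact: subsetDl.
have SD : S u :\: (S u :\: B u) = B u.
  by rewrite setDDr setDv set0U /B setIA setIid.
have := @sum_psi_eq0 (S u) (S u :\: B u) (fun x =>
  \prod_(u' | u' != u) psi (S u') x).
rewrite SD => e; rewrite -[RHS]e //.
  by apply: eq_bigr => x _; rewrite (bigD1 u).
move=> x; apply: eq_bigr => u' u'u; rewrite /psi;
  congr (_ * w #|pred_of_set _|).
apply/setP => v; rewrite !inE; case vB: (v \in S u'); rewrite ?andbF // !andbT.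
have -> : v \in \bigcup_(u' | u' != u) S u' by apply/bigcupP; exists u'.
by case: (v \in S u).
Qed.

End SetSums.

(** * Random masks *)

Section Resample.
Variable R : realFieldType.

Definition ffun_upd (Z W : finType) (f : {ffun Z -> W}) z a : {ffun Z -> W} :=
  [ffun y => if y == z then a else f y].

Lemma avg_resample (Z W : finType) z (G : {ffun Z -> W} -> R) : (0 < #|W|)%N ->
  avg G = avg (fun f => avg (fun a => G (ffun_upd f z a))).
Proof.
(* Exchanging the value at [z] with the fresh sample is an involution. *)
move=> W0; pose h (p : {ffun Z -> W} * W) := (ffun_upd p.1 z p.2, p.1 z).
have hK : involutive h.
  move=> [f a]; rewrite /h /= ffunE eqxx; congr pair; apply/ffunP => y.
  by rewrite !ffunE; case: eqP => [->|].
transitivity (avg (fun p : {ffun Z -> W} * W => G p.1)).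
  by rewrite avg_pair /=; apply: eq_avg => f; rewrite avg_const.
by rewrite (avg_bij _ (inv_bij hK)) avg_pair.
Qed.

Lemma avg_marginal (Z W : finType) z (g : W -> R) : (0 < #|W|)%N ->
  avg (fun f : {ffun Z -> W} => g (f z)) = avg g.
Proof.
move=> W0; rewrite (avg_resample z) //.
rewrite (@eq_avg _ _ _ (fun=> avg g)); last first.
  by move=> f; apply: eq_avg => a; rewrite ffunE eqxx.
rewrite avg_const // card_ffun expn_gt0 W0 //.
Qed.

Variables (V : finType) (m : nat).

(** At distinct points the values of a random [f] are independent. Resampling them one at a time,
    each adds its intersection with the union [B] of the others, which has at most [m * s] points,
    and so costs a factor [M]. *)
Lemma avg_pow_overlap (Z W : finType) (v : W -> {set V}) (lambda M : R)
    (s : nat) :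
  (0 < #|W|)%N -> 0 <= lambda -> 0 <= M -> (forall a, #|v a| = m) ->
  (forall B : {set V}, (#|B| <= m * s)%N ->
    avg (fun a => lambda ^+ #|v a :&: B|) <= M) ->
  forall zs : seq Z, uniq zs -> (size zs <= s)%N ->
  avg (fun f : {ffun Z -> W} =>
    lambda ^+ overlap [seq v (f z) | z <- zs]) <= M ^+ size zs.
Proof.
move=> W0 l0 M0 vm vM; elim=> [_ _|z zs IH /= /andP[zN zs_uniq] sz] /=.
  by rewrite expr0 avg_const_le.
rewrite (avg_resample z) // exprS.
apply: le_trans (_ : M * avg (fun f : {ffun Z -> W} =>
    lambda ^+ overlap [seq v (f z) | z <- zs]) <= _);
  last by rewrite ler_wpM2l // IH // ltnW.
rewrite -avgZ; apply: ler_avg => f.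
have e a : [seq v (ffun_upd f z a z') | z' <- zs] = [seq v (f z') | z' <- zs].
  apply/eq_in_map => z' z'zs; rewrite ffunE; case: eqP => // zz.
  by rewrite -zz z'zs in zN.
rewrite (@eq_avg _ _ _ (fun a => lambda ^+ overlap [seq v (f z') | z' <- zs] *
    lambda ^+ #|v a :&: bigcup_seq [seq v (f z') | z' <- zs]|)); last first.
  by move=> a; rewrite e ffunE eqxx exprD mulrC.
rewrite avgZ mulrC ler_wpM2r ?exprn_ge0 //; apply: vM.
apply: leq_trans (@card_bigcup_seq _ m _ _) _;
  last by rewrite size_map leq_mul2l ltnW ?orbT.
by rewrite all_map; apply/allP => z' _ /=; rewrite vm.
Qed.

Lemma sum_sig (P : pred {set V}) (f : {set V} -> R) :
  \sum_(S : {S : {set V} | P S}) f (val S) = \sum_(S : {set V} | P S) f S.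
Proof.
rewrite [RHS](reindex_omap (val : {S : {set V} | P S} -> _) insub) => [|S PS];
  last by rewrite insubT.
by apply: eq_bigl => S; rewrite valP valK eqxx.
Qed.

Lemma card_supersets (A : {set V}) : (#|A| <= m)%N ->
  #|[set S : {set V} | (A \subset S) && (#|S| == m)]| =
    'C(#|V| - #|A|, m - #|A|).
Proof.
move=> Am; have -> : (#|V| - #|A| = #|~: A|)%N by rewrite -(cardsC A) addKn.
rewrite -cards_draws.
have dis (B : {set V}) : B \subset ~: A -> B :\: A = B.
  by move=> BA; apply/setDidPl; rewrite -[A]setCK -subsets_disjoint.
have inj : {in [set B : {set V} | B \subset ~: A & #|B| == m - #|A|]%N &,
  injective (fun B => A :|: B)}.
  move=> B C; rewrite !inE => /andP[BA _] /andP[CA _].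
  move=> /(congr1 (fun D => D :\: A)).
  by rewrite !setDUl setDv !set0U !dis.
rewrite -(card_in_imset inj); apply: eq_card => S; rewrite inE.
apply/andP/imsetP => [[AS /eqP Sm]|[B]].
  exists (S :\: A); last by rewrite -[LHS](setID S A) (setIidPr AS).
  by rewrite inE setDE subsetIr /= -setDE cardsD (setIidPr AS) Sm.
rewrite inE => /andP[BA /eqP Bm] ->; rewrite subsetUl; split => //.
rewrite cardsU Bm (_ : A :&: B = set0) ?cards0 ?subn0 ?subnKC //.
by apply/eqP; rewrite setI_eq0 disjoint_sym -[A]setCK -subsets_disjoint.
Qed.

Lemma card_msubsets : #|{: {S : {set V} | #|S| == m}}| = 'C(#|V|, m).
Proof.
rewrite card_sig.
transitivity #|[set S : {set V} | S \subset [set: V] & #|S| == m]|.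
  by apply: eq_card => S; rewrite !inE (subsetT S).
by rewrite cards_draws cardsT.
Qed.

(** Factor by factor, [(m - i) / (n - i) <= m / n]. *)
Lemma ffact_ratio_le a n : (m <= n)%N -> (m ^_ a * n ^ a <= m ^ a * n ^_ a)%N.
Proof.
move=> mn; have expE q : (q ^ a = \prod_(i < a) q)%N.
  by rewrite prod_nat_const card_ord.
rewrite !ffact_prod !expE -!big_split leq_prod // => i _ /=.
by rewrite mulnBl mulnBr leq_sub2l // mulnC leq_mul2l mn orbT.
Qed.

(** The probability of containing [A] is a quotient of falling factorials, no larger than if the
    points were chosen independently. *)
Lemma avg_supersets_le (A : {set V}) : (m <= #|V|)%N -> (0 < #|V|)%N ->
  avg (fun S : {S : {set V} | #|S| == m} => (A \subset val S)%:R : R) <=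
  (m%:R / #|V|%:R) ^+ #|A|.
Proof.
move=> mn n0; have [mA|Am] := ltnP m #|A|.
  rewrite (@eq_avg _ _ _ (fun=> 0));
    first by rewrite /avg big1 // mul0r exprn_ge0 // divr_ge0.
  move=> [S /= /eqP Sm]; case: (boolP (A \subset S)) => // /subset_leq_card.
  by rewrite Sm leqNgt mA.
rewrite /avg (sum_sig _ (fun S => (A \subset S)%:R)) card_msubsets.
rewrite [X in X / _ <= _](_ : _ = ('C(#|V| - #|A|, m - #|A|))%:R); last first.
  rewrite -card_supersets // -sum1dep_card natr_sum [RHS]big_mkcond
    [LHS]big_mkcond /=.
  by apply: eq_bigr => S _; case: (_ \subset _); case: (_ == _).
have c0 : 0 < 'C(#|V|, m)%:R :> R by rewrite ltr0n bin_gt0.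
have n0' : 0 < #|V|%:R :> R by rewrite ltr0n.
have An : (#|A| <= #|V|)%N by apply: leq_trans Am mn.
rewrite ler_pdivrMr // exprMn exprVn mulrAC ler_pdivlMr ?exprn_gt0 //.
rewrite -!natrX -!natrM ler_nat.
have := @bin_ffact_ratio #|V| #|A| #|A| m (leqnn _) An;
  rewrite Am mn subnn ffactn0 muln1 => /(_ isT) e.
have p : (0 < #|V| ^_ #|A|)%N by rewrite ffact_gt0.
rewrite -(leq_pmul2r p) mulnAC -e -mulnA [leqRHS]mulnAC mulnC leq_mul2r.
by rewrite ffact_ratio_le ?orbT.
Qed.

(** The power expands as the sum of [mu ^+ #|A|] over the subsets [A] of [S :&: B]; bounding each
    containment probability refolds it into a binomial power. *)
Lemma avg_pow_card (B : {set V}) (mu : R) : 0 <= mu -> (m <= #|V|)%N ->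
  (0 < #|V|)%N ->
  avg (fun S : {S : {set V} | #|S| == m} => (1 + mu) ^+ #|val S :&: B|) <=
  (1 + mu * (m%:R / #|V|%:R)) ^+ #|B|.
Proof.
move=> mu0 mn n0.
have binom (D : {set V}) (x : R) : (1 + x) ^+ #|D| =
  \sum_(A : {set V} | A \subset D) x ^+ #|A|.
  rewrite (sum_subset_card D (fun j => x ^+ j)) exprDn; apply: eq_bigr => j _.
  by rewrite expr1n mul1r mulr_natl.
rewrite (@eq_avg _ _
  (fun S : {S : {set V} | #|S| == m} => (1 + mu) ^+ #|val S :&: B|)
  (fun S => \sum_(A : {set V}) (A \subset B)%:R * mu ^+ #|A| *
    (A \subset val S)%:R)).
  rewrite avg_sum binom [leRHS]big_mkcond ler_sum // => A _.
  rewrite avgZ; case: (A \subset B); last by rewrite !mul0r.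
  by rewrite mul1r exprMn ler_wpM2l ?exprn_ge0 // avg_supersets_le.
move=> S; rewrite binom big_mkcond; apply: eq_bigr => A _; rewrite subsetI.
by case: (A \subset B); case: (A \subset val S) => //=;
  rewrite ?mul0r ?mulr0 ?mulr1 ?mul1r.
Qed.

End Resample.

(** * Existence of a mask with small cube correlations *)

Section GoodMask.
Variables (R : realFieldType) (V Y : finType) (m h k : nat) (w : nat -> R).
Hypothesis w_norm : \sum_(j < m.+1) ('C(m, j))%:R * `|w j| <= 1.
Hypothesis w_orth : forall a b, (b <= a)%N -> (a < h.+1)%N ->
  \sum_(j < (m - a).+1) ('C(m - a, j))%:R * w (b + j)%N = 0.
Hypotheses (m_gt0 : (0 < m)%N) (hm : (h <= m)%N).
Hypothesis m_small : (14 * m ^ 2 * 2 ^ k <= #|V|)%N.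
Hypothesis cardY : #|Y| = (2 ^ #|V|)%N.

Local Notation W := {S : {set V} | #|S| == m}.
Local Notation cube := {ffun 'I_k -> Y * Y}.

Let cube_corr (f : {ffun {ffun 'I_k -> Y} -> W}) (y : cube) : R :=
  avg (fun x : {set V} => \prod_u psi m w (val (f (vertex y u))) x).

Let cardW (S : W) : #|val S| = m. Proof. by apply/eqP; case: S. Qed.

Lemma bernoulli_upper (x : R) r : 0 <= x -> 2 * r%:R * x <= 1 ->
  (1 + x) ^+ r <= 1 + 2 * r%:R * x.
Proof.
move=> x0; elim: r => [|r IH] rx; first by rewrite expr0 mulr0 mul0r addr0.
rewrite -natr1 in rx *; have r0 : 0 <= r%:R :> R by [].
have {}IH := IH _; rewrite exprSr.
apply: le_trans (_ : (1 + 2 * r%:R * x) * (1 + x) <= _); last by nra.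
by rewrite ler_wpM2r ?IH //; nra.
Qed.

Lemma m_le_V : (m <= #|V|)%N.
Proof. by have p := expn_gt0 2 k; nia. Qed.

Lemma W_gt0 : (0 < #|{: W}|)%N.
Proof.
by rewrite card_msubsets bin_gt0 m_le_V.
Qed.

(** Here [8 = 1 + 7], and the constant [14 = 2 * 7] in [m_small] is what makes [bernoulli_upper]
    bound the cost of each mask by 2. *)
Lemma avg_pow8_le (zs : seq {ffun 'I_k -> Y}) : uniq zs ->
  (size zs <= 2 ^ k)%N ->
  avg (fun f : {ffun {ffun 'I_k -> Y} -> W} =>
    8 ^+ overlap [seq val (f z) | z <- zs] : R) <= 2 ^+ size zs.
Proof.
move=> zs_uniq zs_size; apply: (avg_pow_overlap W_gt0 _ _ cardW _ zs_uniq
  zs_size) => //.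
move=> B Bs; have V0 : (0 < #|V|)%N by apply: leq_trans m_gt0 m_le_V.
have := @avg_pow_card R V m B 7 (ler0n _ _) m_le_V V0.
rewrite (_ : 1 + 7 = 8 :> R); last by lra.
move=> /le_trans; apply.
have V0' : 0 < #|V|%:R :> R by rewrite ltr0n.
have le1 : 2 * #|B|%:R * (7 * (m%:R / #|V|%:R)) <= 1 :> R.
  rewrite mulrA mulrA ler_pdivrMr // mul1r -!natrM ler_nat.
  by apply: leq_trans m_small; nia.
apply: le_trans (bernoulli_upper _ le1) _; last by lra.
by rewrite mulr_ge0 // divr_ge0.
Qed.

Lemma vertex_inj (y : cube) : (forall i, (y i).1 != (y i).2) ->
  injective (vertex y).
Proof.
move=> nd u v /ffunP e; apply/ffunP => i; have := e i; rewrite !ffunE.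
have /eqP ne := nd i; case: (u i); case: (v i) => // e'; case: ne; exact/esym.
Qed.

Let card_cube : #|{: {ffun 'I_k -> bool}}| = (2 ^ k)%N.
Proof. by rewrite card_ffun card_bool card_ord. Qed.

Lemma card_setT : #|{set V}| = (2 ^ #|V|)%N.
Proof. by rewrite -[LHS]cardsT -powersetT card_powerset cardsT. Qed.

Let all_m f (y : cube) :
  all (fun S : {set V} => #|S| == m)
    [seq val (f (vertex y u) : W) | u : {ffun 'I_k -> bool}].
Proof. by apply/allP => _ /mapP[u _ ->]; rewrite cardW. Qed.

Let ov f (y : cube) :=
  overlap [seq val (f (vertex y u) : W) | u : {ffun 'I_k -> bool}].

Lemma norm_cube_corr_le f y : `|cube_corr f y| <= 2 ^+ ov f y.
Proof.
apply: le_trans (ler_norm_avg _) _; rewrite /avg ler_pdivrMr; last first.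
  by rewrite ltr0n card_setT expn_gt0.
have := sum_prod_norm_psi_le w_norm (all_m f y).
rewrite -[X in _ * X](_ : #|{set V}|%:R = _); last first.
  by rewrite card_setT natrX.
apply: le_trans; rewrite le_eqVlt; apply/orP; left; apply/eqP.
apply: eq_bigr => x _; rewrite normr_prod big_map big_enum //.
Qed.

(** Either the overlap is below [(h + 1) 2^k / 2] and the correlation vanishes, or
    [4 ^ ov >= 2 ^ ((h + 1) 2^k)], which turns the bound [2 ^ ov] into this one. *)
Lemma norm_cube_corr_le8 f y : `|cube_corr f y| <=
  8 ^+ ov f y * ((2 ^+ h.+1)^-1) ^+ (2 ^ k).
Proof.
have [lt|ge] := ltnP (2 * ov f y) (h.+1 * #|{: {ffun 'I_k -> bool}}|).
  rewrite /cube_corr /avg (sum_prod_psi_eq0 w_orth _ lt) ?mul0r ?normr0.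
    by rewrite mulr_ge0 // ?exprn_ge0 ?invr_ge0 ?exprn_ge0.
  by move=> u; exact: cardW.
apply: le_trans (norm_cube_corr_le f y) _.
rewrite exprVn ler_pdivlMr ?exprn_gt0 // -exprM.
rewrite card_cube in ge.
rewrite (_ : 8 = 2 * 2 ^+ 2 :> R); last by rewrite expr2; lra.
rewrite exprMn -exprM ler_wpM2l ?exprn_ge0 //.
by apply: ler_weXn2l => //; lra.
Qed.

Lemma avg_degenerate_le :
  avg (fun y : cube => [exists i, (y i).1 == (y i).2]%:R : R) <= k%:R / #|Y|%:R.
Proof.
have Y0 : (0 < #|Y|)%N by rewrite cardY expn_gt0.
apply: le_trans (_ : avg (fun y : cube => \sum_i ((y i).1 == (y i).2)%:R) <= _).
  apply: ler_avg => y; case: existsP => [[i yi]|_]; last by rewrite sumr_ge0.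
  by rewrite (bigD1 i) //= yi lerDl sumr_ge0.
rewrite avg_sum (eq_bigr (fun=> #|Y|%:R^-1)).
  by rewrite sumr_const card_ord -[_ *+ k]mulr_natl.
move=> i _; rewrite (avg_marginal i (fun p : Y * Y => (p.1 == p.2)%:R));
  last first.
  by rewrite card_prod muln_gt0 Y0.
rewrite avg_pair /= (@eq_avg _ _ _ (fun=> #|Y|%:R^-1)) ?avg_const // => y.
rewrite /avg (bigD1 y) //= eqxx big1 ?addr0 ?mul1r // => y' /negbTE yy'.
by rewrite eq_sym yy'.
Qed.

(** If all edges are nondegenerate, the vertices are distinct and [avg_pow8_le] costs a factor 2 per
    vertex, lowering [h + 1] to [h]. Degenerate cubes are rare, so the trivial overlap bound
    suffices for them. *)
Lemma avg_cube_corr_le (y : cube) :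
  avg (fun f => `|cube_corr f y|) <=
  [exists i, (y i).1 == (y i).2]%:R * 2 ^+ (m * 2 ^ k) +
    ((2 ^+ h)^-1) ^+ (2 ^ k).
Proof.
have p0 : 0 <= ((2 ^+ h)^-1) ^+ (2 ^ k) :> R by rewrite exprn_ge0 ?invr_ge0
  ?exprn_ge0.
case: existsP => [_|nd].
  rewrite mul1r; apply: le_trans (_ : avg
    (fun _ : {ffun {ffun 'I_k -> Y} -> W} => 2 ^+ (m * 2 ^ k)) <= _).
    apply: ler_avg => f; apply: le_trans (norm_cube_corr_le f y) _.
    apply: ler_weXn2l; first by lra.
    have := overlap_le (all_m f y).
    by rewrite size_map -cardE card_cube.
  apply: le_trans (avg_const_le _ _) _; first by rewrite exprn_ge0.
  by rewrite lerDl.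
rewrite mul0r add0r.
apply: le_trans (_ : ((2 ^+ h.+1)^-1) ^+ (2 ^ k) *
  avg (fun f : {ffun {ffun 'I_k -> Y} -> W} => 8 ^+ ov f y) <= _).
  by rewrite -avgZ; apply: ler_avg => f; rewrite mulrC;
    exact: norm_cube_corr_le8.
have zs_uniq : uniq [seq vertex y u | u : {ffun 'I_k -> bool}].
  rewrite map_inj_uniq ?enum_uniq //; apply: vertex_inj => i.
  by apply/negP => yi; apply: nd; exists i.
have sz : size [seq vertex y u | u : {ffun 'I_k -> bool}] = (2 ^ k)%N.
  by rewrite size_map -cardE card_cube.
have := avg_pow8_le zs_uniq; rewrite sz leqnn => /(_ isT).
rewrite (@eq_avg _ _ _ (fun f : {ffun {ffun 'I_k -> Y} -> W} => 8 ^+ ov f y));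
  last first.
  by move=> f; rewrite /ov -map_comp.
move=> /(ler_wpM2l (_ : 0 <= ((2 ^+ h.+1)^-1) ^+ (2 ^ k))) H.
apply: le_trans (H _) _; first by rewrite exprn_ge0 ?invr_ge0 ?exprn_ge0.
by rewrite -exprMn exprS invfM mulrAC mulVf ?mul1r // pnatr_eq0.
Qed.

Lemma exists_good_mask : exists f : {ffun {ffun 'I_k -> Y} -> W},
  avg (fun y : cube => `|cube_corr f y|) <= (2 / 2 ^+ h) ^+ (2 ^ k).
Proof.
have [f f_le] : exists f : {ffun {ffun 'I_k -> Y} -> W},
    avg (fun y : cube => `|cube_corr f y|) <=
    avg (fun f => avg (fun y : cube => `|cube_corr f y|)).
  by apply: exists_le_avg; rewrite card_ffun expn_gt0 W_gt0.
exists f; apply: le_trans f_le _; rewrite avg_exchange.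
have Y0 : (0 < #|Y|)%N by rewrite cardY expn_gt0.
apply: le_trans (ler_avg avg_cube_corr_le) _; rewrite avgD avg_const;
  last first.
  by rewrite card_ffun expn_gt0 card_prod muln_gt0 Y0.
rewrite (@eq_avg _ _ _ (fun y : cube =>
  2 ^+ (m * 2 ^ k) * [exists i, (y i).1 == (y i).2]%:R)); last first.
  by move=> y; rewrite mulrC.
rewrite avgZ exprMn.
(* Degenerate and nondegenerate cubes contribute at most the same amount each; the resulting factor
   2 is at most [2 ^ (2 ^ k)]. *)
apply: le_trans (_ : 2 * ((2 ^+ h)^-1) ^+ (2 ^ k) <= _); last first.
  rewrite ler_wpM2r ?exprn_ge0 ?invr_ge0 ?exprn_ge0 // -[leLHS]expr1.
  by apply: ler_weXn2l; [lra | rewrite expn_gt0 ].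
set p := (2 ^+ h)^-1 ^+ _; rewrite (_ : 2 * p = p + p); last by lra.
rewrite lerD2r /p.
apply: le_trans (ler_wpM2l _ avg_degenerate_le) _; rewrite ?exprn_ge0 //.
rewrite cardY mulrA ler_pdivrMr ?ltr0n ?expn_gt0 // exprVn -exprM.
rewrite mulrC ler_pdivlMl ?exprn_gt0 //.
rewrite -!natrX -!natrM ler_nat.
(* With [k <= 2 ^ (2 ^ k)], the claim reduces to [(h + 1 + m) 2^k <= #|V|]. *)
have kN : (k <= 2 ^ k)%N by rewrite ltnW // ltn_expl.
have NN : (2 ^ k <= 2 ^ (2 ^ k))%N by rewrite ltnW // ltn_expl.
apply: leq_trans (_ : 2 ^ (h * 2 ^ k) * (2 ^ (2 ^ k) * 2 ^ (m * 2 ^ k)) <= _)%N.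
  by rewrite leq_mul2l leq_mul2r (leq_trans kN NN) !orbT.
rewrite -!expnD leq_exp2l //; apply: leq_trans m_small.
by have N0 := expn_gt0 2 k; nia.
Qed.

End GoodMask.

(** * Protocols *)

Section Protocols.
Variables (R : realFieldType) (n k : nat).
Implicit Types (z : strings n k.+1) (p : protocol n k).

Lemma normr_pm1 b : `|(pm1 b)%:~R : R| = 1.
Proof. by case: b; rewrite /pm1 ?mulrN1z ?normrN normr1. Qed.

(** The product of the [chi i] generalises the indicator of a cylinder intersection to factors with
    values in [[-1, 1]]. *)
Definition cylinders (chi : 'I_k.+1 -> strings n k.+1 -> R) : Prop :=
  (forall i z, `|chi i z| <= 1) /\
  (forall i z z', (forall j, j != i -> z j = z' j) -> chi i z = chi i z').

(** Induction on the protocol tree, with [chi] describing the inputs that reach the current node. A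
    message of player [i] does not depend on the string on forehead [i], so its indicator can be
    absorbed into [chi i]; the two branches double the bound. *)
Lemma correlation_run_le (G : strings n k.+1 -> R) (D : R) :
  (forall chi, cylinders chi -> `|avg (fun z => G z * \prod_i chi i z)| <= D) ->
  forall p c chi, cylinders chi ->
    (forall z, \prod_i chi i z != 0 -> (written p z <= c)%N) ->
  `|avg (fun z => G z * (run p z)%:~R * \prod_i chi i z)| <= 2 ^+ c * D.
Proof.
move=> GD; have D0 : 0 <= D.
  have : cylinders (fun _ _ => 1) by split=> *; rewrite ?normr1.
  by move=> /GD; apply: le_trans.
elim=> [b|i msg p0 IH0 p1 IH1] c chi chi_cyl chi_c /=.
  rewrite (@eq_avg _ _ _ (fun z => (pm1 b)%:~R * (G z * \prod_i chi i z)));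
    last first.
    by move=> z; rewrite mulrCA mulrA.
  rewrite avgZ normrM normr_pm1 mul1r.
  apply: le_trans (GD _ chi_cyl) _.
  by rewrite ler_peMl // exprn_ege1 // ler1n.
case: c chi_c => [|c] chi_c.
  (* A speaking node writes at least one bit, so with no bits left the product of the [chi i] is
     identically 0. *)
  rewrite (@eq_avg _ _ _ (fun=> 0)).
    by rewrite /avg big1 // mul0r normr0 mulr_ge0 ?exprn_ge0.
  move=> z; have [->|/chi_c //] := eqVneq (\prod_i chi i z) 0; exact: mulr0.
pose restrict (b : bool) j z : R :=
  chi j z * (if j == i then (msg (seen i z) == b)%:R else 1).
have restrict_prod b z : \prod_j restrict b j z =
  \prod_j chi j z * (msg (seen i z) == b)%:R.
  by rewrite /restrict big_split /= -big_mkcond big_pred1_eq.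
have restrict_cyl b : cylinders (restrict b).
  case: chi_cyl => chi1 chi2; split=> [j z|j z z' e]; rewrite /restrict.
    rewrite normrM mulr_ile1 //; case: eqP => _; rewrite ?normr1 //.
    by case: (_ == b); rewrite ?normr1 ?normr0.
  rewrite (chi2 _ _ _ e); case: eqP => [ji|//]; congr (_ * (_ == b)%:R);
    congr msg.
  by apply/ffunP => l; rewrite !ffunE e // ji eq_sym neq_lift.
have le b :
    `|avg (fun z => G z * (run (if b then p1 else p0) z)%:~R *
       \prod_j restrict b j z)| <= 2 ^+ c * D.
  have H q (IH : forall c chi, cylinders chi ->
      (forall z, \prod_i chi i z != 0 -> (written q z <= c)%N) ->
      `|avg (fun z => G z * (run q z)%:~R * \prod_i chi i z)| <= 2 ^+ c * D) :
      (forall z, msg (seen i z) = b ->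
        written (Speak i msg p0 p1) z = (written q z).+1) ->
      `|avg (fun z => G z * (run q z)%:~R * \prod_j restrict b j z)| <=
        2 ^+ c * D.
    move=> wq; apply: IH => // z; rewrite restrict_prod mulf_eq0 negb_or.
    by move=> /andP[/chi_c le1]; rewrite pnatr_eq0 eqb0 negbK => /eqP /wq e;
      rewrite e in le1.
  by case: b H => H; apply: H => // z /= ->.
rewrite (@eq_avg _ _ _ (fun z =>
  G z * (run p1 z)%:~R * \prod_j restrict true j z +
    G z * (run p0 z)%:~R * \prod_j restrict false j z)); last first.
  move=> z; rewrite !restrict_prod; case: (msg _) => /=.
    by rewrite mulr0 mulr1 mulr0 addr0.
  by rewrite mulr0 mulr1 mulr0 add0r.
rewrite avgD; apply: le_trans (ler_normD _ _) _.
have := le true; have := le false; rewrite exprS; lra.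
Qed.

Lemma correlation_cost_le (G : strings n k.+1 -> R) (D : R) :
  (forall chi, cylinders chi -> `|avg (fun z => G z * \prod_i chi i z)| <= D) ->
  forall p c, (cost p <= c)%N ->
    avg (fun z => G z * (run p z)%:~R) <= 2 ^+ c * D.
Proof.
move=> GD p c pc; have cyl1 : cylinders (fun _ _ => 1) by split=> *;
  rewrite ?normr1.
have := correlation_run_le GD cyl1 (fun z _ => leq_trans (leq_bigmax z) pc).
rewrite (@eq_avg _ _ _ (fun z => G z * (run p z)%:~R)).
  by apply: le_trans; exact: ler_norm.
by move=> z; rewrite big1 ?mulr1.
Qed.

End Protocols.

(** * From randomized protocols to correlation bounds *)

Section Randomized.
Variables (K : realType) (n k : nat).
Local Open Scope classical_set_scope.

(** This replaces integration over the infinite type of protocols by a finite sum. *)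
Lemma measure_fin_partition (mu : rand_protocol K n k) (E : finType)
    (f : protocol n k -> E) (A : set (protocol n k)) :
  fine (mu A) = \sum_e fine (mu (A `&` [set p | f p = e])).
Proof.
have mA (B : set (protocol n k)) : measurable B by [].
have fin (B : set (protocol n k)) : mu B \is a fin_num.
  exact: fin_num_measure.
have H (s : seq E) : uniq s ->
    mu (A `&` [set p | f p \in s]) =
    (\sum_(e <- s) mu (A `&` [set p | f p = e]))%E.
  elim: s => [_|e s IH /= /andP[es s_uniq]].
    rewrite big_nil (_ : _ `&` _ = classical_sets.set0) ?measure0 //.
    by apply/seteqP; split=> // p [].
  rewrite big_cons -IH // -measureU //.
    congr (mu _); apply/seteqP; split=> p /=; rewrite inE.
      by move=> [Ap /orP[/eqP ?|?]]; [left|right].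
    by move=> [[Ap /eqP ->]|[Ap ->]]; rewrite ?orbT.
  by apply/seteqP; split=> // p [[_ /= ->] [_ /=]]; rewrite (negbTE es).
have := H (index_enum E) (index_enum_uniq E).
rewrite (_ : A `&` _ = A); last first.
  by apply/seteqP; split=> [p []//|p Ap]; split=> //=; rewrite mem_index_enum.
by move=> ->; rewrite -sum_fine.
Qed.

(** The easy direction of Yao's principle. Protocols are grouped by their error set [E], on which
    the output is [F z * (1 - 2 * (z \in E))]. Averaging over [E], each [z] is wrong with
    probability at most [1 / 3] and thus loses at most [2 / 3] of [|G z|]. *)
Lemma distributional_bound (mu : rand_protocol K n k)
    (F : strings n k.+1 -> int) (G : strings n k.+1 -> K) (c : nat) (B : K) :
  (forall z, exists b, F z = pm1 b) ->
  rand_computes mu F -> rand_cost_le mu c ->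
  (forall p, (cost p <= c)%N -> avg (fun z => G z * (run p z)%:~R) <= B) ->
  avg (fun z => G z * (F z)%:~R) - 2 / 3 * avg (fun z => `|G z|) <= B.
Proof.
move=> Fpm mu_F mu_c le_B.
pose err (p : protocol n k) := [set z | run p z != F z]%SET.
pose C := [set p : protocol n k | (cost p <= c)%N].
pose nu (E : {set strings n k.+1}) := fine (mu (C `&` [set p | err p = E])).
have mA (A : set (protocol n k)) : measurable A by [].
have fin (A : set (protocol n k)) : mu A \is a fin_num.
  exact: fin_num_measure.
have nu0 E : 0 <= nu E by rewrite fine_ge0.
have nu1 : \sum_E nu E = 1.
  rewrite -measure_fin_partition (_ : C = ~` [set p | (c < cost p)%N]).
    by rewrite probability_setC // mu_c sube0.
  apply/seteqP; split=> p; rewrite /C /= ltnNge => pc.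
    by apply/negP; rewrite negbK.
  by rewrite -[(_ <= _)%N]negbK; apply/negP.
have nuz z : \sum_(E : {set strings n k.+1} | z \in E) nu E <= 1 / 3.
  apply: (@le_trans _ _ (fine (mu [set p | run p z <> F z]))); last first.
    by rewrite -lee_fin fineK.
  rewrite (measure_fin_partition _ err) big_mkcond ler_sum // => E _.
  case: ifP => zE; last exact: fine_ge0.
  rewrite fine_le ?fin // le_measure ?mem_set // => p [_ /= pE]; split=> //=.
  by move: zE; rewrite -pE inE => /eqP.
have nuB E : nu E * avg (fun z =>
  G z * (F z)%:~R * (1 - 2 * (z \in E)%:R)) <= nu E * B.
  have [->|nuE] := eqVneq (nu E) 0; first by rewrite !mul0r.
  rewrite ler_wpM2l //.
  (* A set of positive weight is the error set of some protocol of cost at most [c], to which the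
     correlation bound applies. *)
  have [[p [Cp pE]]|none] := pselect (exists p, C p /\ err p = E); last first.
    case/eqP: nuE; rewrite /nu (_ : _ `&` _ = classical_sets.set0) ?measure0 //.
    by apply/seteqP; split=> // p [Cp pE]; case: none; exists p.
  apply: le_trans (le_B p Cp); rewrite le_eqVlt; apply/orP; left; apply/eqP.
  apply: eq_avg => z; rewrite -mulrA; congr (_ * _); rewrite -pE inE.
  have [b ->] := Fpm z; have [b' ->] : exists b', run p z = pm1 b'.
    by elim: {Cp pE} p => [b'|i msg p0 IH0 p1 IH1] /=;
      [exists b'|case: (msg _)].
  by case: b; case: b'; rewrite /= ?rmorphN ?rmorph1; lra.
have : \sum_E nu E * avg (fun z =>
  G z * (F z)%:~R * (1 - 2 * (z \in E)%:R)) <= B.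
  by apply: le_trans (ler_sum _ (fun E _ => nuB E)) _;
    rewrite -mulr_suml nu1 mul1r.
apply: le_trans.
rewrite (eq_bigr (fun E => avg (fun z =>
  nu E * (G z * (F z)%:~R * (1 - 2 * (z \in E)%:R))))); last first.
  by move=> E _; rewrite avgZ.
rewrite -avg_sum lerBlDr -avgZ -avgD; apply: ler_avg => z.
rewrite (eq_bigr (fun E => G z * (F z)%:~R * nu E +
  - 2 * (G z * (F z)%:~R) * (if z \in E then nu E else 0))); last first.
  by move=> E _; move: (F z)%:~R => a; case: (z \in E); rewrite /=; ring.
rewrite big_split /= -!mulr_sumr nu1 -big_mkcond mulr1.
have := nuz z.
have : 0 <= \sum_(E : {set strings n k.+1} | z \in E) nu E.
  by rewrite sumr_ge0.
move: (\sum_(E | _) nu E) => s s0 s1.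
have [b ->] := Fpm z.
have : `|G z * (pm1 b)%:~R| = `|G z|.
  by rewrite normrM normr_pm1 mulr1.
move: (G z * _) => g <-.
have : g <= `|g| by exact: ler_norm.
have := normr_ge0 g.
move: `|g| => a a0 ga.
nra.
Qed.

End Randomized.

(** * The hard mask for OR and its communication cost *)

Definition support_set n (x : bits n) : {set 'I_n} := [set i | tnth x i]%SET.

Lemma support_set_bij n : bijective (@support_set n).
Proof.
exists (fun A : {set 'I_n} => [tuple i \in A | i < n]) => [x|A].
  by apply: eq_from_tnth => i; rewrite tnth_mktuple inE.
by apply/setP => i; rewrite inE tnth_mktuple.
Qed.

Lemma OR_substr n m (x : bits n) (S : msubset n m) :
  OR (substr x S) = pm1 (#|support_set x :&: val S| != 0)%N.
Proof.
congr pm1; rewrite /= has_map -lt0n; apply/hasP/card_gt0P.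
  by move=> [i]; rewrite mem_enum => iS xi; exists i; rewrite !inE iS andbT.
by move=> [i]; rewrite !inE => /andP[xi iS]; exists i; rewrite ?mem_enum.
Qed.

Lemma seen_fcons n k x (y : strings n k) :
  seen ord0 (fcons x y : strings n k.+1) = y.
Proof. by apply/ffunP => i; rewrite ffunE fconsS. Qed.

Section Core.
Variables (K : realType) (n m h k : nat).

Lemma avg_card_inter (S : {set 'I_n}) (g : nat -> K) : #|S| = m ->
  avg (fun x => g #|x :&: S|) =
  (2 ^+ m)^-1 * \sum_(j < m.+1) ('C(m, j))%:R * g j.
Proof.
move=> Sm; rewrite /avg card_setT card_ord (sum_set_split S).
rewrite (eq_bigr (fun=> \sum_(j < m.+1) ('C(m, j))%:R * g j)); last first.
  move=> e eS; rewrite -[in RHS]Sm -(sum_subset_card S g);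
    apply: eq_bigr => c cS.
  rewrite (card_mix (subxx S)) // (_ : e :&: S = set0) ?cards0 //.
  by apply/eqP; rewrite setI_eq0 -(setCK S) -subsets_disjoint.
rewrite sumr_const (_ : #|_| = (2 ^ (n - m))%N); last first.
  have -> : (n - m = #|~: S|)%N by have := cardsC S; rewrite card_ord Sm; lia.
  by rewrite -card_powerset; apply: eq_card => e; rewrite !inE.
have mn : (m <= n)%N by have := cardsC S; rewrite card_ord Sm; lia.
set s := \sum_(j < _) _; rewrite -[s *+ _]mulr_natl mulrAC; congr (_ * _).
have -> : (2 ^ n)%:R = (2 ^ (n - m))%:R * 2 ^+ m :> K.
  by rewrite -natrX -natrM -expnD subnK.
by rewrite invfM mulrA mulfV ?mul1r // pnatr_eq0 expn_eq0.
Qed.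

Hypotheses (m_gt0 : (0 < m)%N) (hm : (25 * h ^ 2 <= m)%N).
Hypothesis m_small : (14 * m ^ 2 * 2 ^ k <= n)%N.

Let w : nat -> K := dual_weight K h m.

Let w_norm : \sum_(j < m.+1) ('C(m, j))%:R * `|w j| <= 1.
Proof. exact: sum_norm_dual_weight. Qed.

Let w_orth a b : (b <= a)%N -> (a < h.+1)%N ->
  \sum_(j < (m - a).+1) ('C(m - a, j))%:R * w (b + j)%N = 0.
Proof. by move=> ba ah; apply: sum_dual_weight. Qed.

Let S_card (S : msubset n m) : #|val S| = m. Proof. by apply/eqP; case: S. Qed.

Definition witness (phi : masking n m k) (z : strings n k.+1) : K :=
  psi m w (val (phi (seen ord0 z))) (support_set (z ord0)).

(** For every fixed [y], the number of ones of a uniform [x] inside the mask is binomially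
    distributed, whatever the mask. *)
Lemma avg_witness (phi : masking n m k) (g : strings n k.+1 -> K)
    (f : nat -> K) :
  (forall z, g z = f #|support_set (z ord0) :&: val (phi (seen ord0 z))|) ->
  avg g = (2 ^+ m)^-1 * \sum_(j < m.+1) ('C(m, j))%:R * f j.
Proof.
move=> gf; rewrite avg_fcons avg_exchange.
rewrite (@eq_avg _ _ _
  (fun=> (2 ^+ m)^-1 * \sum_(j < m.+1) ('C(m, j))%:R * f j)).
  by rewrite avg_const // card_ffun card_tuple card_bool expn_gt0 expn_gt0.
move=> y; rewrite -(avg_card_inter f (S_card (phi y))).
rewrite [RHS](avg_bij _ (support_set_bij n)).
by apply: eq_avg => x; rewrite gf seen_fcons fcons0.
Qed.

Lemma avg_norm_witness_le phi : avg (fun z => `|witness phi z|) <= 1.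
Proof.
rewrite (avg_witness (phi := phi) (f := fun j => 2 ^+ m * `|w j|)); last first.
  by move=> z; rewrite /witness /psi normrM ger0_norm ?exprn_ge0.
under eq_bigr do rewrite mulrCA.
by rewrite -mulr_sumr mulKf // expf_neq0 // pnatr_eq0.
Qed.

(** Orthogonality to constants makes the total weight 0, so flipping the sign of all nonzero Hamming
    weights leaves [2 * w 0], at least [2 * (5 / 12)]. *)
Lemma avg_witness_Lift phi :
  5 / 6 <= avg (fun z => witness phi z * (Lift (@OR m) phi z)%:~R).
Proof.
rewrite (avg_witness (phi := phi) (f := fun j =>
  2 ^+ m * (w j * (if j is 0%N then 1 else -1)))); last first.
  move=> z; rewrite /witness /psi /Lift OR_substr -mulrA; congr (_ * (_ * _)).
  by case: #|_|.
under eq_bigr do rewrite mulrCA.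
rewrite -mulr_sumr mulKf ?expf_neq0 ?pnatr_eq0 //.
have := @w_orth 0 0 (leqnn _) (ltn0Sn _).
rewrite subn0 !big_ord_recl /= bin0 mulr1 add0n => e.
rewrite (eq_bigr (fun j : 'I_m =>
  - (('C(m, lift ord0 j))%:R * w (lift ord0 j)))); last first.
  by move=> j _; rewrite mulrN1 mulrN.
rewrite sumrN; have := dual_weight0_ge K h m; rewrite -/w; move: e.
rewrite (eq_bigr (fun j : 'I_m =>
  ('C(m, lift ord0 j))%:R * w (lift ord0 j))) //.
rewrite !mul1r; lra.
Qed.

Lemma exists_hard_mask : exists phi : masking n m k,
  forall chi, @cylinders K n k chi ->
    `|avg (fun z => witness phi z * \prod_i chi i z)| <= 2 / 2 ^+ h.
Proof.
have hm' : (h <= m)%N by nia.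
have V_small : (14 * m ^ 2 * 2 ^ k <= #|'I_n|)%N by rewrite card_ord.
have cardY : #|{: bits n}| = (2 ^ #|'I_n|)%N.
  by rewrite card_tuple card_bool card_ord.
have [f f_le] := exists_good_mask w_norm w_orth m_gt0 hm' V_small cardY.
exists f => chi [chi1 chi2].
have D0 : 0 <= 2 / 2 ^+ h :> K by rewrite divr_ge0 ?exprn_ge0.
rewrite -(@ler_pXn2r _ (2 ^ k)%N) ?nnegrE ?expn_gt0 //.
pose F x (y : strings n k) := psi m w (val (f y)) (support_set x).
pose c i x (y : strings n k) := chi (lift ord0 i) (fcons x y : strings n k.+1).
(* Both signs are treated in order to bound the absolute value: for [k = 0] the exponent [2 ^ k] is
   odd. *)
have F_le (sg : K) : `|sg| = 1 ->
    (sg * avg (fun z => witness f z * \prod_i chi i z)) ^+ (2 ^ k) <=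
      (2 / 2 ^+ h) ^+ (2 ^ k).
  move=> sg1; apply: le_trans f_le.
  have [x0 _] : exists x0 : bits n, True by exists [tuple false | i < n].
  (* Player 0 does not see [x], so an arbitrary [x0] may stand in its place. *)
  pose chi0 y := sg * chi ord0 (fcons x0 y : strings n k.+1).
  have := @cube_bound K _ _ k F chi0 c.
  rewrite (_ : avg _ = sg * avg (fun z => witness f z * \prod_i chi i z));
    last first.
    rewrite -avgZ [RHS]avg_fcons [RHS]avg_exchange; apply: eq_avg => y;
      apply: eq_avg => x.
    rewrite /witness seen_fcons fcons0 big_ord_recl.
    rewrite (chi2 _ (fcons x y) (fcons x0 y)); last first.
      by move=> j; case: (unliftP ord0 j) => [j' ->|->];
        rewrite ?fconsS // eqxx.
    by rewrite /F /chi0 /c; ring.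
  move=> H; apply: le_trans (H _ _ _) _.
  - by move=> y; rewrite normrM sg1 mul1r; exact: chi1.
  - by move=> i x y; exact: chi1.
  - move=> i x y y' e; apply: chi2 => j;
    case: (unliftP ord0 j) => [j' ->|-> _]; last by rewrite !fcons0.
    by rewrite (inj_eq lift_inj) !fconsS; exact: e.
  apply: ler_avg => y; rewrite le_eqVlt; apply/orP; left; apply/eqP; congr `|_|.
  rewrite [RHS](avg_bij _ (support_set_bij n)).
  by apply: eq_avg => x; apply: eq_bigr => u _; rewrite /F.
move: F_le; set a := avg (fun z => witness f z * _) => F_le.
have [a0|a0] := boolP (0 <= a).
  by rewrite (ger0_norm a0) -[a]mul1r; apply: F_le; rewrite normr1.
rewrite ltr0_norm ?ltNge // -[- a]mulN1r.
by apply: F_le; rewrite normrN1.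
Qed.

Lemma exists_mask_large_cost : exists phi : masking n m k,
  forall (mu : rand_protocol K n k) c,
    rand_computes mu (Lift (@OR m) phi) -> rand_cost_le mu c ->
    (2 ^ h <= 12 * 2 ^ c)%N.
Proof.
have [phi phi_le] := exists_hard_mask; exists phi => mu c mu_F mu_c.
have Lpm z : exists b, Lift (@OR m) phi z = pm1 b by eexists.
have := distributional_bound Lpm mu_F mu_c (fun p =>
  @correlation_cost_le K n k _ _ phi_le p c).
have := avg_norm_witness_le phi; have := avg_witness_Lift phi => h1 h2 h3.
(* The left-hand side is [5 / 6 - 2 / 3]. *)
have : 1 / 6 <= 2 ^+ c * (2 / 2 ^+ h) :> K by lra.
rewrite mulrA ler_pdivlMr ?exprn_gt0 // => h4.
by rewrite -(ler_nat K) natrM !natrX; lra.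
Qed.

End Core.

(** * Asymptotics *)

Section ParamBounds.
Variables (K : realType) (delta : K).

Lemma pow2_le_powR (n k : nat) : (1 < n)%N ->
  k%:R <= delta * log2 (n%:R : K) -> (2 ^ k)%:R <= n%:R `^ delta :> K.
Proof.
move=> n1 kn; have n0 : 0 < n%:R :> K by rewrite ltr0n ltnW.
have ln2 : 0 < ln 2 :> K by rewrite ln_gt0 // ltr1n.
rewrite natrX -powR_mulrn // /powR pnatr_eq0 /= gt_eqF // ler_expR.
by move: kn; rewrite /log2 mulrA ler_pdivlMr.
Qed.

(** In terms of [X], [m] is [X ^ 4] rounded down and [n] is [n^delta X^16], since
    [1 - delta = 16 (eps / 4)]. So [25 h^2] is of order [X ^ 2], below [m], and
    [14 m^2 2^k <= 14 X^8 n^delta <= n]; [X >= 20] absorbs the constants. *)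
Lemma parameter_bounds (n k m : nat) (eps X : K) :
  delta < 1 -> eps = (1 - delta) / 4 -> X = n%:R `^ (eps / 4) ->
    m = Num.truncn (n%:R `^ eps) ->
  (1 < n)%N -> 20 <= X -> k%:R <= delta * log2 (n%:R : K) ->
  [/\ (0 < m)%N, (25 * (Num.truncn X + 4) ^ 2 <= m)%N &
      (14 * m ^ 2 * 2 ^ k <= n)%N].
Proof.
move=> d1 epsE XE mE n1 X20 kn.
have n0 : 0 < n%:R :> K by rewrite ltr0n ltnW.
have nn : n%:R != 0 :> K by rewrite gt_eqF.
have X0 : 0 <= X by lra.
have e4 : n%:R `^ eps = X ^+ 4.
  by rewrite -powR_mulrn // XE -powRrM; congr (_ `^ _); field.
have X2 : 400 <= X ^+ 2 by rewrite expr2; nra.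
have m_itv : m%:R <= X ^+ 4 < m.+1%:R by rewrite mE -e4 truncn_itv // powR_ge0.
case/andP: m_itv => m_le; rewrite -natr1 => m_gt.
have X4 : X ^+ 4 = X ^+ 2 * X ^+ 2 by rewrite -exprD.
split.
- by rewrite -(ltr_nat K); nra.
- have hX : (Num.truncn X + 4)%:R <= X + 4 by rewrite natrD lerD2r truncn_le.
  have : (25 * (Num.truncn X + 4) ^ 2)%:R < m%:R + 1 :> K.
    rewrite natrM natrX.
    move: ((_ + _)%:R) hX (ler0n K (Num.truncn X + 4)) => h hX h0.
    have : h ^+ 2 <= (X + 4) ^+ 2 by rewrite ler_sqr ?nnegrE //; lra.
    have : (X + 4) ^+ 2 <= 2 * X ^+ 2 by rewrite !expr2; nra.
    nra.
  by rewrite natr1 ltr_nat ltnS.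
have kN := pow2_le_powR n1 kn.
have nE : n%:R = n%:R `^ delta * X ^+ 16 :> K.
  rewrite -powR_mulrn // XE -powRrM -powRD; last by rewrite nn implybT.
  by rewrite -[LHS]powRr1 ?ltW //; congr (_ `^ _); rewrite epsE; field.
rewrite -(ler_nat K) natrM nE mulrC; apply: ler_pM => //; rewrite natrM natrX.
have : m%:R ^+ 2 <= X ^+ 8.
  by rewrite (exprM X 4 2) ler_sqr ?nnegrE // exprn_ge0.
have X16 : X ^+ 16 = X ^+ 8 * X ^+ 8 by rewrite -exprD.
have X4_ge : 14 <= X ^+ 4 by rewrite X4; nra.
have : 14 <= X ^+ 8 by rewrite (exprD X 4 4); nra.
rewrite X16; move: (X ^+ 8) (m%:R ^+ 2) => y s; nra.
Qed.

End ParamBounds.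

Theorem theorem3p1 (K : realType) (delta : K) (hdelta : delta < 1) :
  let eps : K := (1 - delta) / 4 in
  exists2 c : K, 0 < c &
  exists n0 : nat, forall n k : nat, (n0 <= n)%N ->
    let m := Num.truncn (n%:R `^ eps : K) in
    k%:R <= delta * log2 (n%:R : K) ->
    exists phi : masking n m k,
      ((n%:R `^ c : K)%:E <= rand_cc K (Lift (@OR m) phi))%E.
Proof.
move=> eps; have eps0 : 0 < eps by rewrite /eps; lra.
exists (eps / 4); first by lra.
(* Chosen so that [n ^ (eps / 4) >= 20] and [n > 1]. *)
exists (Num.truncn (20 `^ (4 / eps) : K)).+2 => n k n_ge m kn.
have n1 : (1 < n)%N by apply: leq_trans n_ge.
have X20 : 20 <= n%:R `^ (eps / 4).
  have -> : 20 = (20 `^ (4 / eps)) `^ (eps / 4) :> K.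
    rewrite -powRrM (_ : 4 / eps * (eps / 4) = 1) ?powRr1 //.
    by field; rewrite gt_eqF.
  apply: ge0_ler_powR; rewrite ?nnegrE ?powR_ge0 //; first by lra.
  have /andP[_ /ltW lt] := truncn_itv (powR_ge0 20 (4 / eps)).
  by apply: le_trans lt _; rewrite ler_nat ltnW.
have [m0 hm m_small] := parameter_bounds hdelta erefl erefl (erefl m) n1 X20 kn.
have [phi phi_cost] := exists_mask_large_cost K m0 hm m_small.
exists phi; apply: le_ereal_inf_tmp => _ [c [mu [mu_F mu_c]] <-].
have := phi_cost mu c mu_F mu_c; set t := Num.truncn _ => le_c.
have tc : (t < c)%N.
  (* The shift by 4 in [h = t + 4] absorbs the constant, as [12 < 2 ^ 4]. *)
  have : (2 ^ (t + 4) < 2 ^ (c + 4))%N.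
    by apply: leq_ltn_trans le_c _; rewrite expnD mulnC ltn_pmul2l // expn_gt0.
  by rewrite ltn_exp2l // ltn_add2r.
rewrite lee_fin; have /andP[_ lt] := truncn_itv (powR_ge0 n%:R (eps / 4)).
by apply: le_trans (ltW lt) _; rewrite ler_nat.
Qed.
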